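(* Let $G$ be a finite group. Then $G$ is a solvable SST-group if and only if $G$ has a normal subgroup $N$ such that $N$ is a solvable PST-group and $G/N''$ is a solvable SST-group. Likewise, $G$ is a solvable BT-group if and only if $G$ has a normal subgroup $N$ such that $N$ is a solvable PST-group and $G/N''$ is a solvable BT-group.
   Context: All groups are finite. $N''=(N')'$ is the second derived subgroup of $N$. Two subgroups $A,B$ of a group permute if $AB=BA$. A supplement of $H$ in $G$ is a subgroup $K\le G$ with $G=HK$. A subgroup $H$ of a group $G$ is SS-permutable in $G$ if $H$ has a supplement $K$ in $G$ such that $H$ permutes with every Sylow subgroup of $K$ (for all primes); S-permutable in $G$ if $H$ permutes with all Sylow subgroups of $G$; semipermutable in $G$ if $H$ permutes with every subgroup $X$ of $G$ such that $(|H|,|X|)=1$. $G$ is an SST-group (resp. PST-group, BT-group) if SS-permutability (resp. S-permutability, semipermutability) is transitive: whenever $H\le K\le G$, $H$ has the property in $K$ and $K$ has the property in $G$, then $H$ has the property in $G$. *)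

(* Defs.v *)
From mathcomp Require Import all_boot all_fingroup all_solvable.

Set Implicit Arguments.
Unset Strict Implicit.
Unset Printing Implicit Defensive.

Local Open Scope group_scope.

Section Permutability.

Variable gT : finGroupType.
Implicit Types G H K P X : {group gT}.

Definition permutes H K : Prop := H * K = K * H.

Definition supplement K H G : Prop := K \subset G /\ H * K = G.

Definition permutes_with_Sylows H K : Prop :=
  forall (p : nat) (P : {group gT}),
    prime p -> p.-Sylow(K) P -> permutes H P.

Definition SS_permutable H G : Prop :=
  H \subset G /\
  exists K : {group gT}, supplement K H G /\ permutes_with_Sylows H K.

Definition S_permutable H G : Prop :=
  H \subset G /\ permutes_with_Sylows H G.

Definition semipermutable H G : Prop :=
  H \subset G /\
  forall X : {group gT}, X \subset G -> coprime #|H| #|X| -> permutes H X.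

(* Here Q H G reads "H has the embedding property Q in G". *)
Definition transitive_in (Q : {group gT} -> {group gT} -> Prop) G : Prop :=
  forall H K : {group gT},
    H \subset K -> K \subset G -> Q H K -> Q K G -> Q H G.

Definition SST_group G : Prop := transitive_in SS_permutable G.
Definition PST_group G : Prop := transitive_in S_permutable G.
Definition BT_group G : Prop := transitive_in semipermutable G.

End Permutability.

(* Main.v *)
Require Import Defs.
From mathcomp Require Import all_boot all_fingroup all_solvable.

Set Implicit Arguments.
Unset Strict Implicit.
Unset Printing Implicit Defensive.

Local Open Scope group_scope.

(** Both equivalences come from arithmetical descriptions of the solvable
    BT-groups and SST-groups, which are then lifted through the normal subgroup
    Z = N''.

    Say that G is primary permutable when every p-subgroup permutes with every
    q-subgroup, for all p <> q.  A solvable group G is a BT-group iff it is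
    primary permutable (solvable_BTP), and it is an SST-group iff moreover
    |P : O_p(G)| divides p for every Sylow p-subgroup P (solvable_SSTP).  That
    transitivity implies these conditions is proved by induction on |G|: such a
    G has a nontrivial normal Sylow subgroup R, because in a primary permutable
    group the Sylow subgroup for the largest prime is normal, and every subgroup
    of R, as well as every complement of R, has the embedding property in G
    (solvable_transitive_primary_embedded).

    Primary permutable groups and PST-groups share one property: a p'-element
    normalises every subgroup lying between Z1 and A, whenever Z1 <= A are
    normal in G and A / Z1 is a p-group (p'power_action).  For a solvable group
    with this property G' is nilpotent, and for each p either G is p-nilpotent
    or its Sylow p-subgroup is normal and abelian (p'power_action_dichotomy).
    The point is that a p'-group which normalises every subgroup of a p-group P
    centralises P unless P is abelian.

    Let now N be a normal solvable PST-subgroup such that G / Z is primary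
    permutable.  Then M = N' is nilpotent and Z = M'.  If p divides |Z|, the
    Sylow p-subgroups of G / Z cannot be abelian, for otherwise the dichotomy
    in N would make Z a p'-group; hence G / Z is p-nilpotent, and so is G, as
    M' consists of non-generators of the nilpotent normal subgroup M
    (PST_der2_p_nilpotent).  Consequently, for each p dividing |Z|, all the
    p'-elements of G lie in O_{p'}(G), while an element of Z lying in all these
    cores is trivial; this is what lifts both conditions from G / Z to G.

    The direct implications hold with N = 1. *)

(** * Permuting subgroups *)

Section Permuting.

Variable gT : finGroupType.
Implicit Types A B D G H K P Q R S T X Y Z : {group gT}.

Lemma permutes_sym A B : permutes A B -> permutes B A.
Proof. by move=> permAB; apply: esym. Qed.

Lemma permutes_norm A B : A \subset 'N(B) -> permutes A B.
Proof. exact: normC. Qed.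

Lemma permutes1g A B : A :=: 1 -> permutes A B.
Proof. by move=> A1; rewrite /permutes A1 mul1g mulg1. Qed.

Lemma permutesg1 A B : B :=: 1 -> permutes A B.
Proof. by move=> B1; rewrite /permutes B1 mul1g mulg1. Qed.

Lemma permutesJ A B x : permutes A B -> permutes (A :^ x)%G (B :^ x)%G.
Proof. by move=> permAB; rewrite /permutes /= -!conjsMg permAB. Qed.

(** By Dedekind's law B is the intersection of D with the subgroup B A. *)
Lemma permutes_norm_inter A B D :
    permutes A B -> A \subset 'N(D) -> B \subset D -> D :&: A \subset B ->
  A \subset 'N(B).
Proof.
move=> permAB nDA sBD sDAB.
have defB : D :&: (B <*> A) = B.
  by rewrite (comm_joingE (permutes_sym permAB)) setIC -group_modl // setIC mulGSid.
rewrite -defB normsI //.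
by rewrite (subset_trans (joing_subr B A)) ?normG.
Qed.

Lemma sub_Sylow_group B D :
    (forall q, prime q -> exists2 Q : {group gT}, q.-Sylow(B) Q & Q \subset D) ->
  B \subset D.
Proof.
move=> sylD; apply/setIidPl/eqP; rewrite eqEcard subsetIl /=.
apply: dvdn_leq => //; apply/dvdn_partP=> // q.
rewrite mem_primes => /andP[q_pr _]; have [Q sylQ sQD] := sylD q q_pr.
by rewrite -(card_Hall sylQ) cardSg // subsetI sQD (pHall_sub sylQ).
Qed.

(** The elements of B that stabilise the set B A under right multiplication form
    a subgroup, which contains a Sylow subgroup of B for every prime. *)
Lemma permutes_Sylow A B :
    (forall q, prime q -> exists2 Q : {group gT}, q.-Sylow(B) Q & permutes A Q) ->
  permutes A B.
Proof.
move=> permA; pose S := B * A.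
have sBC: B \subset 'C[S | 'Rs].
  apply: (@sub_Sylow_group B 'C[S | 'Rs]%G) => q q_pr.
  have [Q sylQ permAQ] := permA q q_pr; exists Q => //.
  apply/subsetP=> x Qx; apply/astab1P; rewrite /= rcosetE.
  have SQ : S * Q = S.
    rewrite /S -mulgA permAQ mulgA; congr (_ * _).
    by apply: mulGSid; apply: pHall_sub sylQ.
  apply/eqP; rewrite eqEcard card_rcoset leqnn andbT -{2}SQ.
  by rewrite mulgS ?sub1set.
have sABS : A * B \subset S.
  apply/subsetP=> _ /mulsgP[a b Aa Bb ->].
  have /astab1P := subsetP sBC b Bb; rewrite /= rcosetE => <-.
  by rewrite mem_rcoset mulgK; apply: (subsetP (mulG_subr _ _)).
apply/eqP; rewrite eqEcard sABS /=.
by have := card_invg (A * B); rewrite invMG => ->.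
Qed.

(** Subgroups of coprime prime power orders permute.  The numbers p and q need
    not be prime: when p is not, the only p-group is the trivial one. *)
Definition primary_permutable G : Prop :=
  forall (p q : nat) X Y, p != q -> X \subset G -> Y \subset G ->
    p.-group X -> q.-group Y -> permutes X Y.

Lemma p_elt_pdiv (p : nat) (x : gT) :
  x != 1 -> p.-elt x -> [/\ prime p, p %| #[x] & exists m, #[x] = (p ^ m.+1)%N].
Proof. by move=> ntx px; apply: pgroup_pdiv; rewrite ?cycle_eq1. Qed.

(** Every p'-element is a product of elements of prime power order for primes
    other than p. *)
Lemma p'elt_closed p G D :
    (forall (q : nat) x, q != p -> x \in G -> q.-elt x -> x \in D) ->
  forall y, y \in G -> p^'.-elt y -> y \in D.
Proof.
move=> qD y Gy p'y; rewrite -cycle_subG.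
apply: sub_Sylow_group => q q_pr; have [Q sylQ] := Sylow_exists q <[y]>.
exists Q => //; apply/subsetP=> x Qx; have qx := mem_p_elt (pHall_pgroup sylQ) Qx.
have yx := subsetP (pHall_sub sylQ) x Qx.
have [eqp | npq] := eqVneq q p; last first.
  by apply: qD qx; rewrite // (subsetP _ x yx) ?cycle_subG.
suffices ->: x = 1 by apply: group1.
apply/eqP; rewrite -order_eq1 (@pnat_1 p #[x]) // -eqp //.
by rewrite eqp; apply: mem_p_elt p'y yx.
Qed.

Section TopPrime.

Variables (p : nat) (G P : {group gT}).
Hypotheses (permG : primary_permutable G) (sylP : p.-Sylow(G) P).

(** The number of Sylow p-subgroups of P <y> divides q, by induction on the
    order of y, and it is 1 modulo p > q. *)
Lemma q_elt_norm_Sylow q y :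
  prime p -> q < p -> y \in G -> q.-elt y -> y \in 'N(P).
Proof.
move=> p_pr ltqp; have [n] := ubnP #[y]; elim: n y => // n IHn y leyn Gy qy.
have [-> | nty] := eqVneq y 1; first exact: group1.
have [q_pr q_dv_y _] := p_elt_pdiv nty qy.
have sPG := pHall_sub sylP; have pP := pHall_pgroup sylP.
have syG : <[y]> \subset G by rewrite cycle_subG.
have npq : p != q by rewrite neq_ltn ltqp orbT.
have tiP z : q.-elt z -> #|P * <[z]>| = (#|P| * #[z])%N.
  move=> qz; rewrite TI_cardMg //; apply: coprime_TIg.
  by apply: pnat_coprime pP _; apply: pi_pnat qz _; rewrite !inE eq_sym.
have permPy := permG npq sPG syG pP qy.
pose J := (P <*> <[y]>)%G.
have defJ : J :=: P * <[y]> by rewrite /J /= comm_joingE.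
have sJG : J \subset G by rewrite join_subG sPG.
have sPJ : P \subset J by apply: joing_subl.
have sylPJ := pHall_subl sPJ sJG sylP.
pose z := y ^+ q; have qz : q.-elt z by apply: p_eltX.
have ozq : #[y] = (#[z] * q)%N by rewrite orderXdiv // divnK.
have Nz : z \in 'N(P).
  apply: IHn => //; last exact: groupX.
  by rewrite -(ltnS _ n) (leq_trans _ leyn) // ltnS ozq ltn_Pmulr ?prime_gt1.
have defPz : P <*> <[z]> = P * <[z]>.
  by rewrite joingC norm_joinEl ?cycle_subG // normC ?cycle_subG.
have sPzN : P <*> <[z]> \subset 'N_J(P).
  rewrite subsetI !join_subG sPJ normG !cycle_subG Nz !andbT.
  by rewrite (subsetP (joing_subr _ _)) // mem_cycle.
have: #|J : 'N_J(P)| %| q.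
  rewrite -(@dvdn_pmul2l #|'N_J(P)|) ?cardG_gt0 // Lagrange ?subsetIl //.
  have -> : #|J| = (#|P <*> <[z]>| * q)%N by rewrite defJ defPz !tiP // ozq mulnA.
  by rewrite dvdn_pmul2r ?prime_gt0 // cardSg.
have:= card_Syl_mod J p_pr; rewrite (card_Syl sylPJ) => modp dvd_q.
have idx1 : #|J : 'N_J(P)| = 1%N.
  have [//|ne1] := eqVneq #|J : 'N_J(P)| 1%N.
  have eqd := prime_nt_dvdP q_pr ne1 dvd_q.
  by move: modp; rewrite eqd modn_small // => q1; rewrite q1 in q_pr.
have sJN : J \subset 'N(P).
  by move/eqP: idx1; rewrite indexg_eq1 subsetI => /andP[].
by rewrite (subsetP sJN) // (subsetP (joing_subr _ _)) ?cycle_id.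
Qed.

Lemma top_Sylow_normal : {in \pi(G), forall q, q <= p} -> P <| G.
Proof.
move=> le_p; rewrite /normal (pHall_sub sylP) /=.
apply: sub_Sylow_group => q q_pr.
have [eqp | npq] := eqVneq q p; first by exists P; rewrite ?eqp ?normG.
have [Q sylQ] := Sylow_exists q G; exists Q => //.
apply/subsetP=> y Qy; have qy : q.-elt y := mem_p_elt (pHall_pgroup sylQ) Qy.
have Gy := subsetP (pHall_sub sylQ) y Qy.
have [-> | nty] := eqVneq y 1; first exact: group1.
have [P1 | ntP] := eqsVneq P 1; first by rewrite P1 (subsetP (norms1 G)).
have [p_pr _ _] := pgroup_pdiv (pHall_pgroup sylP) ntP.
apply: (q_elt_norm_Sylow p_pr _ Gy qy); rewrite ltn_neqAle npq le_p // mem_primes.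
have [_ dv_y _] := p_elt_pdiv nty qy.
by rewrite q_pr cardG_gt0 (dvdn_trans dv_y) // order_dvdG.
Qed.

End TopPrime.

(** If X <= P and Y <= Q with P, Q Sylow, then X Y is the intersection of the
    subgroups X Q and P Y. *)
Lemma primary_permutable_Sylow G :
    (forall (p q : nat) X Q, prime p -> prime q -> q != p ->
       X \subset G -> p.-group X -> q.-Sylow(G) Q -> permutes X Q) ->
  primary_permutable G.
Proof.
move=> permG p q X Y npq sXG sYG pX qY.
have [X1 | ntX] := eqsVneq X 1; first exact: permutes1g.
have [Y1 | ntY] := eqsVneq Y 1; first exact: permutesg1.
have [p_pr _ _] := pgroup_pdiv pX ntX; have [q_pr _ _] := pgroup_pdiv qY ntY.
have [P sylP sXP] := Sylow_superset sXG pX.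
have [Q sylQ sYQ] := Sylow_superset sYG qY.
have permXQ : permutes X Q by apply: (permG p q); rewrite // eq_sym.
have permYP : permutes Y P by apply: (permG q p).
have tiQP : Q :&: P = 1.
  apply: coprime_TIg; apply: pnat_coprime (pHall_pgroup sylQ) _.
  by apply: pi_pnat (pHall_pgroup sylP) _; rewrite !inE.
have defY : Q :&: (P <*> Y) = Y.
  by rewrite comm_joingE; [rewrite -group_modr // tiQP mul1g | apply/permutes_sym].
apply/comm_group_setP.
have -> : X * Y = (X <*> Q) :&: (P <*> Y).
  rewrite (comm_joingE permXQ) -{1}defY group_modl //.
  by rewrite (subset_trans sXP) ?joing_subl.
exact: groupP.
Qed.

(** * Transitive embedding properties *)

(** The induction shared by semipermutability and SS-permutability.  Here E H G
    reads: H has the embedding property E in G. *)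
Section TransitiveEmbedding.

Variable E : {group gT} -> {group gT} -> Prop.

Hypothesis E_normal : forall A G, A <| G -> E A G.
Hypothesis E_pgroup : forall (p : nat) A H, p.-group A -> H \subset A -> E H A.
Hypothesis E_permutes : forall (p q : nat) H G Q,
  p.-group H -> prime q -> q != p -> q.-Sylow(G) Q -> E H G -> permutes H Q.
(* The last premise matters only when R is a Sylow p-subgroup of G and T is a
   complement of R. *)
Hypothesis E_supplement : forall (p : nat) R T G,
    p.-group R -> R <| G -> R * T = G ->
    (p^'.-group T -> forall S : {group gT}, S \subset R -> T \subset 'N(S)) ->
  E T G.
Hypothesis E_subgroup : forall H T G,
  H \subset T -> T \subset G -> E H G -> E H T.

(** All subgroups of prime power order have the embedding property in G. *)
Definition primary_embedded G : Prop :=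
  forall (p : nat) H, H \subset G -> p.-group H -> E H G.

Lemma primary_embedded_permutable G : primary_embedded G -> primary_permutable G.
Proof.
move=> pE; apply: primary_permutable_Sylow => p q X Q p_pr q_pr nqp sXG pX sylQ.
by apply: (E_permutes pX q_pr nqp sylQ); apply: pE pX.
Qed.

(** Transitivity in G is not obviously inherited by all subgroups of G, but it is
    inherited by those having the embedding property in G. *)
Lemma transitive_in_embedded G T :
  T \subset G -> E T G -> transitive_in E G -> transitive_in E T.
Proof.
move=> sTG ET trG H K sHK sKT EH EK.
apply: (E_subgroup _ sTG); first exact: subset_trans sKT.
apply: (trG H K) => //; first exact: subset_trans sTG.
exact: (trG K T).
Qed.

Lemma embedded_sub_normal_pgroup G (p : nat) A S :
  transitive_in E G -> A <| G -> p.-group A -> S \subset A -> E S G.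
Proof.
move=> trG nsAG pA sSA; apply: (trG S A) => //; first exact: normal_sub nsAG.
  exact: E_pgroup pA sSA.
exact: E_normal.
Qed.

Lemma p'group_norm_sub_pgroup G (p : nat) A S K :
    transitive_in E G -> A <| G -> p.-group A -> S \subset A ->
    K \subset G -> p^'.-group K ->
  K \subset 'N(S).
Proof.
move=> trG nsAG pA sSA sKG p'K; apply: sub_Sylow_group => q q_pr.
have [Q sylQ] := Sylow_exists q K; exists Q => //.
have [-> | ntQ] := eqsVneq Q 1; first exact: sub1G.
have sQG := subset_trans (pHall_sub sylQ) sKG.
have nqp : q != p.
  have [_ q_dv _] := pgroup_pdiv (pHall_pgroup sylQ) ntQ.
  have := pgroupP (pgroupS (pHall_sub sylQ) p'K) q q_pr q_dv.
  by rewrite !inE.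
have [T sylT sQT] := Sylow_superset sQG (pHall_pgroup sylQ).
have pS := pgroupS sSA pA.
have permST : permutes S T.
  exact: (E_permutes pS q_pr nqp sylT (embedded_sub_normal_pgroup trG nsAG pA sSA)).
have tiAT : A :&: T = 1.
  rewrite setIC; apply: coprime_TIg; apply: pnat_coprime (pHall_pgroup sylT) _.
  by apply: pi_pnat pA _; rewrite !inE eq_sym.
rewrite (subset_trans sQT) // (permutes_norm_inter (permutes_sym permST) _ sSA) //.
  by rewrite (subset_trans (pHall_sub sylT)) ?normal_norm.
by rewrite tiAT sub1G.
Qed.

(** By induction on |G|.  As soon as G has a nontrivial normal Sylow r-subgroup
    R, the r-subgroups lie in R, and any other p-subgroup X lies in a complement
    K of R, so that X is embedded in K, and K in G.  To find R, take a normal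
    subgroup M of prime index s: it is primary permutable by induction, so its
    Sylow subgroup R for the largest prime r is normal. *)
Lemma solvable_transitive_primary_embedded G :
  solvable G -> transitive_in E G -> primary_embedded G.
Proof.
have [n] := ubnP #|G|; elim: n G => // n IHn G leGn solG trG.
have IH H : H \proper G -> E H G -> primary_embedded H.
  move=> ltHG EH; have sHG := proper_sub ltHG.
  apply: IHn (solvableS sHG solG) (transitive_in_embedded sHG EH trG).
  by rewrite (leq_trans (proper_card ltHG)).
have [G1 | ntG] := eqsVneq G 1.
  move=> p H sHG pH; apply: E_normal; rewrite G1 in sHG.
  by rewrite (trivGP sHG) normal1.
suffices [r [R [sylR nsRG ntR]]]:
    exists r : nat, exists R, [/\ r.-Sylow(G) R, R <| G & R :!=: 1].
  move=> p X sXG pX.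
  have [r_pr _ _] := pgroup_pdiv (pHall_pgroup sylR) ntR.
  have [eqpr | npr] := eqVneq p r.
    apply: (embedded_sub_normal_pgroup trG nsRG (pHall_pgroup sylR)).
    by rewrite (sub_normal_Hall sylR nsRG sXG) -eqpr.
  have r'X : r^'.-group X by apply: pi_pgroup pX _; rewrite !inE.
  have [K hallK sXK] := Hall_superset solG sXG r'X.
  have sKG := pHall_sub hallK.
  have ltKG : K \proper G.
    rewrite properEneq sKG andbT; apply: contra ntR => /eqP eqKG.
    have r'G : r^'.-group G by rewrite -eqKG (pHall_pgroup hallK).
    rewrite -subG1 -(coprime_TIg (pnat_coprime (pHall_pgroup sylR) r'G)).
    by rewrite subsetI subxx (pHall_sub sylR).
  have EK : E K G.
    apply: (E_supplement (pHall_pgroup sylR) nsRG) => [|_ S sSR].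
      have : K \in [complements to R in G] by rewrite (compl_pHall K sylR).
      by case/complP.
    exact: p'group_norm_sub_pgroup trG nsRG (pHall_pgroup sylR) sSR sKG (pHall_pgroup hallK).
  exact: (trG X K) (IH K ltKG EK p X sXK pX) EK.
have [M nsMG s_pr] := sol_prime_factor_exists solG ntG.
set s := #|G : M| in s_pr; have sMG := normal_sub nsMG.
have oG : #|G| = (#|M| * s)%N by rewrite Lagrange.
have ltMG : M \proper G.
  by rewrite properEneq sMG andbT; apply: contraTneq s_pr => eqMG;
     rewrite /s (group_inj eqMG) indexgg.
have [M1 | ntM] := eqsVneq M 1.
  exists s; exists G; split=> //.
  by rewrite /pHall subxx indexgg /pgroup oG M1 cards1 mul1n pnat_id.
have topSylow H : H \proper G -> E H G -> H :!=: 1 -> exists r : nat, exists R : {group gT},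
    [/\ prime r, r.-Sylow(H) R, R \char H, R :!=: 1 & {in \pi(H), forall q, q <= r}].
  move=> ltHG EH ntH; pose r := max_pdiv #|H|; have [R sylR] := Sylow_exists r H.
  have le_r : {in \pi(H), forall q, q <= r} by move=> q; apply: max_pdiv_max.
  exists r; exists R; split=> //.
  - by rewrite max_pdiv_prime // cardG_gt1.
  - have nsRH := top_Sylow_normal (primary_embedded_permutable (IH H ltHG EH)) sylR le_r.
    by rewrite -(normal_Hall_pcore sylR nsRH) gFchar.
  by rewrite -cardG_gt1 (card_Hall sylR) p_part_gt1 pi_max_pdiv cardG_gt1.
have [r [R [r_pr sylR chRM ntR le_r]]] := topSylow M ltMG (E_normal nsMG) ntM.
have nsRG : R <| G := char_normal_trans chRM nsMG.
have [eqsr | nsr] := eqVneq s r; last first.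
  exists r; exists R; split=> //.
  rewrite pHallE (subset_trans (pHall_sub sylR)) //= oG partnM ?cardG_gt0 ?(prime_gt0 s_pr) //.
  by rewrite (card_Hall sylR) (@part_p'nat r s) ?muln1 // pnatE // !inE.
(* R is a Sylow subgroup of G unless |G : M| = r.  In that case, K being a
   complement of R in M, the Frattini argument gives G = R N_G(K).  If K is normal
   in G then a Sylow subgroup of K, or G itself when K = 1, will do; otherwise the
   induction applies to T = N_G(K), and R S is a normal Sylow subgroup of G for S
   Sylow in T. *)
have [K hallK] := Hall_exists r^' (solvableS sMG solG).
pose T := ('N_G(K))%G.
have sKM := pHall_sub hallK.
have MN : M * T = G by apply: Hall_Frattini_arg hallK; rewrite ?(solvableS sMG).
have defM : R * K = M.
  have : K \in [complements to R in M] by rewrite (compl_pHall K sylR).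
  by case/complP.
have sKT : K \subset T by rewrite subsetI (subset_trans sKM sMG) normG.
have defG : R * T = G by rewrite -MN -defM -mulgA (mulSGid sKT).
have hallKG : r^'.-Hall(G) K.
  apply/pHallP; split; first exact: subset_trans sKM sMG.
  rewrite (card_Hall hallK) oG partnM ?cardG_gt0 ?(prime_gt0 s_pr) // eqsr.
  by rewrite (@part_p'nat r^' r) ?muln1 // pnatNK pnat_id.
have [eqTG | ltTG] := eqVproper (subsetIl G 'N(K)).
  have nsKG : K <| G by rewrite /normal (subset_trans sKM) // -{1}eqTG subsetIr.
  have [K1 | ntK] := eqsVneq K 1.
    exists r; exists G; split=> //.
    have rM : r.-nat #|M| by rewrite -defM K1 mulg1; apply: pHall_pgroup sylR.
    by rewrite /pHall subxx indexgg /pgroup oG pnatM rM eqsr pnat_id.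
  have ltKG : K \proper G := sub_proper_trans sKM ltMG.
  have [q [Q [q_pr sylQ chQK ntQ _]]] := topSylow K ltKG (E_normal nsKG) ntK.
  exists q; exists Q; split=> //; last exact: char_normal_trans nsKG.
  have [_ q_dv _] := pgroup_pdiv (pHall_pgroup sylQ) ntQ.
  apply: (subHall_Sylow hallKG _ sylQ).
  exact: pgroupP (pgroupS (pHall_sub sylQ) (pHall_pgroup hallK)) q q_pr q_dv.
have r_dv_T : r %| #|T|.
  have: #|M| * s %| #|M| * #|T|.
    by rewrite -oG mul_cardG MN dvdn_mulr.
  by rewrite dvdn_pmul2l // eqsr.
have ET : E T G.
  apply: (E_supplement (pHall_pgroup sylR) nsRG defG) => r'T.
  by have := pgroupP r'T r r_pr r_dv_T; rewrite !inE eqxx.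
have [S sylS] := Sylow_exists r T.
have nsST : S <| T.
  apply: (top_Sylow_normal (primary_embedded_permutable (IH T ltTG ET)) sylS) => q.
  move/(piSg (subsetIl G _)); rewrite mem_primes /= => /and3P[q_pr _].
  rewrite oG Euclid_dvdM // => /orP[q_dv|].
    by apply: le_r; rewrite mem_primes q_pr cardG_gt0.
  by rewrite eqsr dvdn_prime2 // => /eqP->.
have nRG := normal_norm nsRG; have sTG : T \subset G by apply: subsetIl.
have sSG := subset_trans (normal_sub nsST) sTG.
have defRS : R <*> S = R * S by rewrite norm_joinEr // (subset_trans sSG).
exists r; exists (R <*> S)%G; split=> /=.
- rewrite /pHall join_subG (normal_sub nsRG) sSG {1}defRS pgroupM.
  rewrite (pHall_pgroup sylR) (pHall_pgroup sylS) /=.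
  have defG' : (R <*> S) * T = G.
    by rewrite defRS -mulgA (mulSGid (normal_sub nsST)).
  rewrite -{1}defG' indexMg; apply: pnat_dvd (indexgS _ (joing_subr R S)) _.
  by case/and3P: sylS.
- rewrite /normal join_subG (normal_sub nsRG) sSG /= -{1}defG mul_subG //.
    by rewrite (subset_trans (joing_subl R S)) ?normG.
  by rewrite normsY ?(normal_norm nsST) // (subset_trans sTG).
apply: contraNneq ntR => RS1; rewrite -subG1 -RS1; exact: joing_subl.
Qed.

End TransitiveEmbedding.

(** * Solvable BT-groups *)

Lemma primary_permutable_coprime G H X :
    primary_permutable G -> H \subset G -> X \subset G -> coprime #|H| #|X| ->
  permutes H X.
Proof.
move=> permG sHG sXG coHX.
apply: permutes_Sylow => q q_pr; have [Q sylQ] := Sylow_exists q X.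
exists Q => //; apply/permutes_sym/permutes_Sylow => p p_pr.
have [P sylP] := Sylow_exists p H; exists P => //; apply/permutes_sym.
have sPG := subset_trans (pHall_sub sylP) sHG.
have sQG := subset_trans (pHall_sub sylQ) sXG.
have [eqpq | npq] := eqVneq p q; last first.
  exact: permG npq sPG sQG (pHall_pgroup sylP) (pHall_pgroup sylQ).
have [P1 | ntP] := eqsVneq P 1; first exact: permutes1g.
have [_ p_dv _] := pgroup_pdiv (pHall_pgroup sylP) ntP.
have p'X : p^'.-group X.
  by rewrite (coprime_p'group _ (pHall_pgroup sylP)) // (coprimegS (pHall_sub sylP)) //
             coprime_sym.
have Q1 : Q :=: 1.
  apply: card1_trivg; rewrite (card_Hall sylQ) -eqpq part_p'nat //.
exact: permutesg1.
Qed.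

Lemma primary_permutable_BT G : primary_permutable G -> BT_group G.
Proof.
move=> permG H K sHK sKG _ _; split=> [|X sXG]; first exact: subset_trans sKG.
by apply: primary_permutable_coprime permG _ sXG; apply: subset_trans sKG.
Qed.

Lemma semipermutable_normal A G : A <| G -> semipermutable A G.
Proof.
move=> nsAG; split=> [|X sXG _]; first exact: normal_sub.
by apply/permutes_sym/permutes_norm/(subset_trans sXG)/normal_norm.
Qed.

Lemma semipermutable_Sylow (p q : nat) H G Q :
  p.-group H -> q != p -> q.-Sylow(G) Q -> semipermutable H G -> permutes H Q.
Proof.
move=> pH nqp sylQ [sHG permH]; apply: permH (pHall_sub sylQ) _.
apply: pnat_coprime pH _; apply: pi_pnat (pHall_pgroup sylQ) _.
by rewrite !inE.
Qed.

(** A subgroup X of order prime to |T| is a p-subgroup of R; if X <> 1, then T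
    is a p'-group, which normalises X by assumption. *)
Lemma semipermutable_supplement (p : nat) R T G :
    p.-group R -> R <| G -> R * T = G ->
    (p^'.-group T -> forall S : {group gT}, S \subset R -> T \subset 'N(S)) ->
  semipermutable T G.
Proof.
move=> pR nsRG defG nT; have sTG : T \subset G by rewrite -defG mulG_subr.
split=> // X sXG coTX.
have oX_dv : #|X| %| #|R|.
  have coXT : coprime #|X| #|T| by rewrite coprime_sym.
  by rewrite -(Gauss_dvdl _ coXT) mul_cardG defG (dvdn_trans (cardSg sXG)) // dvdn_mulr.
have pX : p.-group X := pnat_dvd oX_dv pR.
have [X1 | ntX] := eqsVneq X 1; first exact: permutesg1.
have p'T : p^'.-group T := coprime_p'group coTX pX ntX.
have hallR : p.-Sylow(G) R by case: (coprime_mulpG_Hall defG pR p'T).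
apply/permutes_norm/nT => //.
by rewrite (sub_normal_Hall hallR).
Qed.

Lemma solvable_BT_primary_permutable G :
  solvable G -> BT_group G -> primary_permutable G.
Proof.
move=> solG btG; apply: (@primary_embedded_permutable (@semipermutable gT)).
  by move=> p q H A Q pH _; apply: semipermutable_Sylow.
apply: solvable_transitive_primary_embedded btG => //.
- exact: semipermutable_normal.
- move=> p A H pA sHA; split=> // X sXA coHX.
  have [X1 | ntX] := eqsVneq X 1; first exact: permutesg1.
  have p'H := coprime_p'group coHX (pgroupS sXA pA) ntX.
  by apply/permutes1g/card1_trivg/(pnat_1 (pgroupS sHA pA) p'H).
- by move=> p q H A Q pH _; apply: semipermutable_Sylow.
- exact: semipermutable_supplement.
move=> H T A sHT sTA [sHA permH]; split=> // X sXT.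
by apply: permH; apply: subset_trans sTA.
Qed.

(** * Solvable SST-groups *)

Lemma supplement_index H K G : supplement K H G -> #|G : K| %| #|H|.
Proof.
case=> sKG defG; rewrite -(@dvdn_pmul2l #|K|) ?cardG_gt0 // Lagrange //.
by rewrite -defG mulnC mul_cardG dvdn_mulr.
Qed.

Lemma pHall_p'index pi Q K G :
  K \subset G -> pi^'.-nat #|G : K| -> pi.-Hall(K) Q -> pi.-Hall(G) Q.
Proof.
move=> sKG pi'K /and3P[sQK piQ pi'Q].
rewrite /pHall (subset_trans sQK) // piQ -(Lagrange_index sKG sQK).
by rewrite pnatM pi'K.
Qed.

(** A supplement K of H contains a Sylow q-subgroup of G, and the Sylow
    q-subgroups of G = K H are the H-conjugates of those of K. *)
Lemma SS_permutes_Sylow (p q : nat) H G Q :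
    p.-group H -> q != p -> q.-Sylow(G) Q -> SS_permutable H G ->
  permutes H Q.
Proof.
move=> pH nqp sylQ [sHG [K [supK permK]]]; have [sKG defG] := supK.
have [Q1 | ntQ] := eqsVneq Q 1; first exact: permutesg1.
have [q_pr _ _] := pgroup_pdiv (pHall_pgroup sylQ) ntQ.
have [Q0 sylQ0] := Sylow_exists q K.
have q'K : q^'.-nat #|G : K|.
  apply: pnat_dvd (supplement_index supK) _; apply: pi_pnat pH _.
  by rewrite !inE eq_sym.
have [x Gx defQ] := Sylow_trans (pHall_p'index sKG q'K sylQ0) sylQ.
have KH : K * H = G by rewrite -[RHS]invGid -defG invMG.
have : x \in K * H by rewrite KH.
case/mulsgP=> k h Kk Hh defx.
have sylQk : q.-Sylow(K) (Q0 :^ k) by rewrite pHallJ.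
have := permutesJ h (permK q (Q0 :^ k)%G q_pr sylQk).
by rewrite /permutes /= -conjsgM -defx -defQ conjGid.
Qed.

Lemma SS_normal A G : A <| G -> SS_permutable A G.
Proof.
move=> nsAG; split; first exact: normal_sub.
exists G; split; first by split=> //; apply: mulSGid; apply: normal_sub.
move=> p P _ sylP; apply/permutes_sym/permutes_norm.
exact: subset_trans (pHall_sub sylP) (normal_norm nsAG).
Qed.

Lemma solvable_SST_primary_SS G :
    solvable G -> SST_group G ->
  forall (p : nat) H, H \subset G -> p.-group H -> SS_permutable H G.
Proof.
move=> solG sstG; apply: (solvable_transitive_primary_embedded _ _ _ _ _ solG sstG).
- exact: SS_normal.
- move=> p A H pA sHA; split=> //; exists A; split.
    by split=> //; apply: mulSGid.
  move=> q P q_pr sylP.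
  have [eqqp | nqp] := eqVneq q p.
    rewrite /permutes (pHall_id sylP) ?eqqp //.
    by rewrite (mulSGid sHA) (mulGSid sHA).
  apply/permutesg1/card1_trivg; rewrite (card_Hall sylP) part_p'nat //.
  by apply: pi_pnat pA _; rewrite !inE eq_sym.
- move=> p q H A Q pH _; exact: SS_permutes_Sylow.
- move=> p R T A pR nsRA defA _; have sTA : T \subset A by rewrite -defA mulG_subr.
  split=> //; exists R; split.
    split; first exact: normal_sub.
    by rewrite (normC (subset_trans sTA (normal_norm nsRA))).
  move=> q P q_pr sylP.
  have [eqqp | nqp] := eqVneq q p.
    rewrite /permutes (pHall_id sylP) ?eqqp //.
    exact: normC (subset_trans sTA (normal_norm nsRA)).
  apply/permutesg1/card1_trivg; rewrite (card_Hall sylP) part_p'nat //.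
  by apply: pi_pnat pR _; rewrite !inE eq_sym.
(* A supplement K of H in A yields the supplement K :&: T of H in T. *)
move=> H T A sHT sTA [_ [K [[sKA defA] permK]]]; split=> //.
exists (K :&: T)%G; split.
  split; first exact: subsetIr.
  by rewrite /= group_modl // defA; apply/setIidPr.
move=> q Q q_pr sylQ.
have sQK : Q \subset K := subset_trans (pHall_sub sylQ) (subsetIl K T).
have [P sylP sQP] := Sylow_superset sQK (pHall_pgroup sylQ).
have permHP := permK q P q_pr sylP.
have defQ : Q :=: P :&: T.
  apply/esym/(sub_pHall sylQ).
  - exact: pgroupS (subsetIl P T) (pHall_pgroup sylP).
  - by rewrite subsetI sQP (subset_trans (pHall_sub sylQ)) ?subsetIr.
  by rewrite setSI // (pHall_sub sylP).
apply/comm_group_setP.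
rewrite defQ group_modl // -(comm_joingE permHP); exact: groupP.
Qed.

(** * Groups whose p'-elements normalise the subgroups of normal p-sections *)

Lemma p'sub_index (p : nat) A Z B :
    Z \subset A -> B \subset A -> permutes Z B ->
    p.-nat #|A : Z| -> p^'.-group B ->
  B \subset Z.
Proof.
move=> sZA sBA permZB pAZ p'B.
have dvB : #|B : Z| %| #|B| := dvdn_indexg B Z.
have dvA : #|B : Z| %| #|A : Z|.
  rewrite -indexMg -(comm_joingE permZB) indexSg ?joing_subl //.
  by rewrite join_subG sZA.
by rewrite -indexg_eq1 (pnat_1 (pnat_dvd dvA pAZ) (pnat_dvd dvB p'B)).
Qed.

(** Every p'-element of G acts on each normal p-section A / Z of G as a power
    automorphism, i.e., it normalises every subgroup of A / Z.  The subgroups of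
    A / Z are represented by the subgroups H with Z <= H <= A, so that no quotient
    group appears; p is not assumed prime, but otherwise A = Z. *)
Definition p'power_action G : Prop :=
  forall (p : nat) Z A H y, Z <| G -> A <| G -> Z \subset H -> H \subset A ->
    p.-nat #|A : Z| -> y \in G -> p^'.-elt y -> y \in 'N(H).

Lemma permutes_norm_section (p : nat) G Z A H Q :
    Z <| G -> A <| G -> Z \subset H -> H \subset A -> p.-nat #|A : Z| ->
    Q \subset G -> p^'.-group Q -> permutes H Q ->
  Q \subset 'N(H).
Proof.
move=> nsZG nsAG sZH sHA pAZ sQG p'Q permHQ.
have sAQZ : A :&: Q \subset Z.
  apply: (p'sub_index (subset_trans sZH sHA) (subsetIl A Q) _ pAZ).
    apply/permutes_sym/permutes_norm/(subset_trans (subsetIr A Q)).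
    exact: subset_trans sQG (normal_norm nsZG).
  exact: pgroupS (subsetIr A Q) p'Q.
apply: (permutes_norm_inter (permutes_sym permHQ) _ sHA).
  exact: subset_trans sQG (normal_norm nsAG).
exact: subset_trans sZH.
Qed.

(** With P a Sylow p-subgroup of H = Z P, a q-element x permutes with P and hence
    with H. *)
Lemma primary_permutable_p'power_action G :
  primary_permutable G -> p'power_action G.
Proof.
move=> permG p Z A H y nsZG nsAG sZH sHA pAZ Gy p'y.
have sHG := subset_trans sHA (normal_sub nsAG).
apply: (p'elt_closed _ Gy p'y) => q x nqp Gx qx.
have sxG : <[x]> \subset G by rewrite cycle_subG.
rewrite -cycle_subG.
apply: (permutes_norm_section nsZG nsAG sZH sHA pAZ sxG).
  by apply: pi_pnat qx _; rewrite !inE.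
have [P sylP] := Sylow_exists p H.
have nZ X : X \subset G -> Z * X = X * Z.
  by move=> sXG; apply/esym/normC/(subset_trans sXG)/normal_norm.
have sPG := subset_trans (pHall_sub sylP) sHG.
have defH : Z * P = H.
  have -> : Z * P = (Z <*> P)%G by rewrite /= (comm_joingE (nZ P sPG)).
  have sZPH : Z <*> P \subset H by rewrite join_subG sZH (pHall_sub sylP).
  apply/eqP; rewrite eqEsubset sZPH /= -indexg_eq1.
  rewrite -(@pnat_1 p #|H : Z <*> P|) //.
    apply: pnat_dvd pAZ; rewrite (dvdn_trans (indexgS _ (joing_subl Z P))) //.
    by rewrite indexSg.
  by case/and3P: sylP => _ _; apply: pnat_dvd; rewrite indexgS ?joing_subr.
rewrite /permutes -defH -mulgA.
have -> : P * <[x]> = <[x]> * P.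
  apply: (permG p q P <[x]>%G) => //; first by rewrite eq_sym.
  exact: pHall_pgroup sylP.
by rewrite mulgA (nZ <[x]>%G sxG) mulgA.
Qed.

(** H is S-permutable in A and A is normal in G, so a single use of transitivity
    makes H permute with the Sylow subgroups of G. *)
Lemma PST_p'power_action G : PST_group G -> p'power_action G.
Proof.
move=> pstG p Z A H y nsZG nsAG sZH sHA pAZ Gy p'y.
have sAG := normal_sub nsAG; have sZA := subset_trans sZH sHA.
have SHA : S_permutable H A.
  split=> // q P q_pr sylP.
  have [eqqp | nqp] := eqVneq q p.
    have defA : H * P = A.
      have sHPA : H * P \subset A by rewrite mul_subG ?(pHall_sub sylP).
      have permZP : permutes Z P.
        apply/permutes_sym/permutes_norm.
        apply: subset_trans (normal_norm nsZG).
        exact: subset_trans (pHall_sub sylP) sAG.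
      have defZP : (Z <*> P)%G :=: A.
        apply/eqP; rewrite eqEsubset join_subG sZA (pHall_sub sylP) /=.
        rewrite -indexg_eq1 -(@pnat_1 p #|A : Z <*> P|) //.
          by apply: pnat_dvd pAZ; rewrite indexgS ?joing_subl.
        rewrite -eqqp; case/and3P: sylP => _ _; apply: pnat_dvd.
        by rewrite indexgS ?joing_subr.
      apply/eqP; rewrite eqEsubset sHPA /= -{1}defZP /= (comm_joingE permZP).
      by rewrite mulSg.
    apply/comm_group_setP; rewrite defA; exact: groupP.
  have sPH : P \subset H.
    apply: subset_trans sZH.
    apply: (p'sub_index sZA (pHall_sub sylP) _ pAZ).
      apply/permutes_sym/permutes_norm.
      apply: subset_trans (normal_norm nsZG).
      exact: subset_trans (pHall_sub sylP) sAG.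
    by apply: pi_pnat (pHall_pgroup sylP) _; rewrite !inE.
  by rewrite /permutes mulGSid // mulSGid.
have SAG : S_permutable A G.
  split=> // q P _ sylP; apply/permutes_sym/permutes_norm.
  exact: subset_trans (pHall_sub sylP) (normal_norm nsAG).
have [_ permHG] := pstG H A sHA sAG SHA SAG.
apply: (p'elt_closed _ Gy p'y) => q x nqp Gx qx.
have sxG : <[x]> \subset G by rewrite cycle_subG.
have [Q sylQ sxQ] := Sylow_superset sxG qx.
have [-> | ntx] := eqVneq x 1; first exact: group1.
have [q_pr _ _] := p_elt_pdiv ntx qx.
have nHQ : Q \subset 'N(H).
  apply: (permutes_norm_section nsZG nsAG sZH sHA pAZ (pHall_sub sylQ)).
    by apply: pi_pnat (pHall_pgroup sylQ) _; rewrite !inE.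
  exact: permHG sylQ.
by rewrite (subsetP nHQ) // -cycle_subG.
Qed.

End Permuting.

Lemma p'power_action_quotient (gT : finGroupType) (G Z : {group gT}) :
  Z <| G -> p'power_action G -> p'power_action (G / Z)%G.
Proof.
move=> nsZG actG p Z1 A1 H1 y1 nsZ1 nsA1 sZH sHA pAZ Gy p'y.
have [Z0 defZ0 sZZ0 nsZ0] := inv_quotientN nsZG nsZ1.
have [A0 defA0 sZA0 nsA0] := inv_quotientN nsZG nsA1.
have [H0 defH0 sZH0 sH0] := inv_quotientS nsZG (subset_trans sHA (normal_sub nsA1)).
case/morphimP: (Gy) => x Nx Gx defy; pose y := x.`_p^'.
have Gy0 : y \in G by apply: groupX.
have Ny : y \in 'N(Z) by apply: groupX.
have defy1 : y1 = coset Z y by rewrite morph_constt // -defy constt_p_elt.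
have nZ (X : {group gT}) : X \subset G -> X \subset 'N(Z).
  by move=> sXG; rewrite (subset_trans sXG) ?normal_norm.
have sAG := normal_sub nsA0; have sZG := normal_sub nsZ0.
have sZ0H0 : Z0 \subset H0 by rewrite -(quotientSGK (nZ Z0 sZG) sZH0) -defZ0 -defH0.
have sHA0 : H0 \subset A0 by rewrite -(quotientSGK (nZ H0 sH0) sZA0) -defA0 -defH0.
have nHy : y \in 'N(H0).
  apply: (actG p Z0 A0) => //; last exact: p_elt_constt.
  rewrite -(index_quotient_eq _ (subset_trans sZ0H0 sHA0) (nZ A0 sAG)) -?defA0 -?defZ0 //.
  exact: subset_trans (subsetIr A0 Z) sZZ0.
by apply/normP; rewrite defH0 defy1 -quotientJ // (normP nHy).
Qed.

(** The automorphism group of a cyclic group is abelian. *)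
Lemma norm_cycle_der1 (gT : finGroupType) (D : {group gT}) (u : gT) :
  D \subset 'N(<[u]>) -> D^`(1) \subset 'C[u].
Proof.
move=> nuD; rewrite -[D^`(1)]/[~: D, D] gen_subG.
apply/subsetP=> _ /imset2P[x y Dx Dy ->].
have nu z w : z \in D -> w \in <[u]> -> w ^ z \in <[u]>.
  by move=> Dz uw; rewrite memJ_norm // (subsetP nuD).
have uJ w : w \in <[u]> -> w ^ (x * y) = w ^ (y * x).
  have /cycleP[i ux] := nu x u Dx (cycle_id u).
  have /cycleP[j uy] := nu y u Dy (cycle_id u).
  case/cycleP=> k ->; rewrite !conjXg; congr (_ ^+ k).
  by rewrite !conjgM ux uy !conjXg ux uy -!expgM mulnC.
pose v := u ^ (y * x)^-1.
have uv : v \in <[u]> by apply: nu (cycle_id u); rewrite groupV groupM.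
have := uJ v uv; rewrite commgC conjgM /v conjgKV => /conjg_fixP fixu.
by apply/cent1P/commgP; rewrite commg1_sym.
Qed.

(** The minimal normal subgroups B of G are cyclic: if B is a p-group and P is a
    Sylow p-subgroup of G, then an element b <> 1 of B centralised by P generates
    a subgroup normalised by P and by all p'-elements.  So G' centralises B, and
    induction applies to G / B. *)
Lemma p'power_action_der1_nil (gT : finGroupType) (G : {group gT}) :
  solvable G -> p'power_action G -> nilpotent G^`(1).
Proof.
have [n] := ubnP #|G|; elim: n gT G => // n IHn gT G leGn solG actG.
have [G1 | ntG] := eqsVneq G 1.
  by rewrite (nilpotentS (der_sub 1 G)) // G1 nilpotent1.
have [B minB sBG] := minnormal_exists ntG (normG G).
have [nBG ntB /is_abelemP[p p_pr abelB]] := minnormal_solvable minB sBG solG.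
have pB := abelem_pgroup abelB; have nsBG : B <| G by apply/andP.
have [P sylP] := Sylow_exists p G; have pP := pHall_pgroup sylP.
have sBP : B \subset P by rewrite (normal_sub_max_pgroup (Hall_max sylP) pB).
have nsBP : B <| P := normalS sBP (pHall_sub sylP) nsBG.
have /trivgPn[b /setIP[Bb Zb] ntb] := meet_center_nil (pgroup_nil pP) nsBP ntB.
have sbB : <[b]> \subset B by rewrite cycle_subG.
have nbG : G \subset 'N(<[b]>).
  apply: sub_Sylow_group => q q_pr.
  have [eqqp | nqp] := eqVneq q p.
    exists P; rewrite ?eqqp // cents_norm // cent_cycle.
    by rewrite sub_cent1; case/setIP: Zb.
  have [Q sylQ] := Sylow_exists q G; exists Q => //; apply/subsetP=> y Qy.
  apply: (actG p 1%G B) => //; first exact: normal1.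
  - by rewrite sub1G.
  - by rewrite indexg1.
  - exact: subsetP (pHall_sub sylQ) y Qy.
  by apply: pi_pnat (mem_p_elt (pHall_pgroup sylQ) Qy) _; rewrite !inE.
have defB : <[b]> = B.
  have [_ minB'] := mingroupP minB; apply: (minB' <[b]>%G) => //.
  by rewrite cycle_eq1 ntb.
have cBG : G^`(1) \subset 'C(B) by rewrite -defB cent_cycle norm_cycle_der1.
have nilGB : nilpotent (G^`(1) / B).
  rewrite quotient_der //.
  have ltGB : #|(G / B)%G| < n by apply: leq_trans (ltn_quotient ntB sBG) _.
  by apply: IHn ltGB _ _; [apply: quotient_sol | apply: p'power_action_quotient].
have nBG' := subset_trans (der_sub 1 G) nBG.
have /lcnP[m Lm] := nilGB.
have Lm1 : 'L_m.+1(G^`(1)) / B = 1 by rewrite -Lm; apply: morphim_lcn.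
apply/lcnP; exists m.+1; apply/trivgP.
rewrite /= lcnSn; apply: (@subset_trans _ _ [~: B, G^`(1)]); last first.
  by rewrite commGC (commG1P cBG).
rewrite commSg // -quotient_sub1 ?Lm1 //; exact: subset_trans (lcn_sub _ _) nBG'.
Qed.

Lemma coprime_cent_prod (gT : finGroupType) (A G : {group gT}) :
    A \subset 'N(G) -> coprime #|G| #|A| -> solvable G ->
  [~: G, A] * 'C_G(A) = G.
Proof.
move=> nGA coGA solG; have sRG : [~: G, A] \subset G by rewrite commg_subl.
have nRG : G \subset 'N([~: G, A]) by apply: commg_norml.
have nRA : A \subset 'N([~: G, A]) by apply: commg_normr.
have /= defC := coprime_norm_quotient_cent nGA nRA
  (coprimeSg sRG coGA) (solvableS sRG solG).
apply/eqP; rewrite eqEsubset mul_subG ?subsetIl //=.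
rewrite -quotientSK // defC subsetI subxx.
by rewrite quotient_cents2r.
Qed.

Lemma coprime_commGid (gT : finGroupType) (A G : {group gT}) :
    A \subset 'N(G) -> coprime #|G| #|A| -> solvable G ->
  [~: G, A, A] = [~: G, A].
Proof.
move=> nGA coGA solG; apply/eqP; rewrite eqEsubset commSg ?commg_subl //=.
rewrite -{1}(coprime_cent_prod nGA coGA solG) commMG //=; last first.
  rewrite normsR ?(subset_trans (subsetIl G _) (commg_norml G A)) //.
  by rewrite cents_norm ?subsetIr.
have /commG1P -> : 'C_G(A) \subset 'C(A) by apply: subsetIr.
by rewrite mulg1.
Qed.

(** Let D be the group of all elements normalising every subgroup of P.  It is
    normalised by P and D' centralises P, so W = [P, Y] lies in D and
    W = [W, Y] <= D' is central in P.  Since P = W C_P(Y), it remains to see that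
    W and C_P(Y) cannot both be nontrivial. *)
Lemma coprime_power_action (gT : finGroupType) (p : nat) (P Y : {group gT}) :
    p.-group P -> p^'.-group Y ->
    (forall H : {group gT}, H \subset P -> Y \subset 'N(H)) ->
  Y \subset 'C(P) \/ (abelian P /\ [~: P, Y] = P).
Proof.
move=> pP p'Y nY.
pose D := [group of \bigcap_(H : {group gT} | H \subset P) 'N(H)].
have nPY : Y \subset 'N(P) by apply: nY.
have coPY : coprime #|P| #|Y| := pnat_coprime pP p'Y.
have solP := pgroup_sol pP.
have sYD : Y \subset D by apply/bigcapsP.
have nHD (H : {group gT}) : H \subset P -> D \subset 'N(H) by move=> sHP; apply: bigcap_inf.
have nDP : P \subset 'N(D).
  apply/subsetP=> x Px; rewrite inE; apply/bigcapsP=> H sHP.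
  have sHxP : (H :^ x^-1)%G \subset P by rewrite -(conjGid (groupVr Px)) conjSg.
  by rewrite -(conjsgKV x H) normJ conjSg nHD.
set W := [~: P, Y].
have sWP : W \subset P by rewrite commg_subl.
have sWD : W \subset D by rewrite (subset_trans (commgS _ sYD)) // commg_subr.
have cPD : D^`(1) \subset 'C(P).
  rewrite centsC; apply/subsetP=> u Pu; rewrite -sub_cent1.
  by apply/norm_cycle_der1/nHD; rewrite cycle_subG.
have cPW : W \subset 'C(P).
  by rewrite /W -coprime_commGid // (subset_trans _ cPD) // commgSS.
have defP : W * 'C_P(Y) = P := coprime_cent_prod nPY coPY solP.
have abW : abelian W := subset_trans cPW (centS sWP).
have [W1 | ntW] := eqsVneq W 1.
  by left; rewrite centsC; apply/commG1P.
have [C1 | ntC] := eqsVneq 'C_P(Y) 1.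
  by rewrite C1 mulg1 in defP; right; rewrite -{1}defP.
have tiWC : W :&: 'C(Y) = 1.
  have nWY : Y \subset 'N(W) by apply: commg_normr.
  have := coprime_abel_cent_TI nWY (coprimeSg sWP coPY) abW.
  by rewrite [[~: _, _]]coprime_commGid.
have [p_pr p_dvW _] := pgroup_pdiv (pgroupS sWP pP) ntW.
have [_ p_dvC _] := pgroup_pdiv (pgroupS (subsetIl P _) pP) ntC.
(* If z in W and f in C_P(Y) have order p, then Y normalises <z f>, but [z f, y]
   is a nontrivial element of W for some y, so that <z f> <= W and f in W. *)
have [z Wz oz] := Cauchy p_pr p_dvW; have [f Cf of_] := Cauchy p_pr p_dvC.
have [Pf cYf] := setIP Cf; have Pz := subsetP sWP z Wz.
have czf : commute z f by apply: (centP (subsetP cPW z Wz)).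
have ozf : (z * f) ^+ p = 1.
  by rewrite expgMn // -{1}oz -of_ !expg_order mulg1.
have ntz : z != 1 by rewrite -order_gt1 oz prime_gt1.
have /subsetPn[y Yy ncyz] : ~~ (Y \subset 'C[z]).
  apply: contra ntz; rewrite sub_cent1 => cYz.
  by rewrite -in_set1 -[[set 1]]/(1 : {set gT}) -tiWC inE Wz.
pose c := [~ z, y]; have Wc : c \in W by apply: mem_commg.
have ntc : c != 1 by apply: contra ncyz => /commgP c1; apply/cent1P/commute_sym.
have cVy : [~ z * f, y] = c.
  have /eqP f1 : [~ f, y] == 1 by apply/commgP; apply: (centP cYf).
  rewrite commMgJ f1 mulg1; apply/conjg_fixP/commgP.
  exact: (centP (subsetP cPW c Wc)).
have Vc : c \in <[z * f]>.
  have nVY : Y \subset 'N(<[z * f]>) by apply: nY; rewrite cycle_subG groupM.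
  rewrite -cVy commgEl groupM ?groupV ?cycle_id // memJ_norm ?cycle_id //.
  exact: subsetP nVY y Yy.
have Wzf : z * f \in W.
  rewrite -cycle_subG.
  have dv_zf : #[z * f] %| p by rewrite order_dvdn ozf.
  have oc : #[c] = p.
    by apply/(prime_nt_dvdP p_pr); rewrite ?order_eq1 // (dvdn_trans _ dv_zf) ?order_dvdG.
  have <- : <[c]> = <[z * f]>; last by rewrite -cycle_subG in Wc.
  apply/eqP; rewrite eqEcard cycle_subG Vc /= -!orderE oc.
  by rewrite dvdn_leq ?prime_gt0.
have : f \in W :&: 'C(Y) by rewrite inE cYf andbT -(groupMl f Wz).
by rewrite tiWC => /set1P f1; move: p_pr; rewrite -of_ f1 order1.
Qed.

(** In H = G / O_{p'}(G) the derived subgroup is a p-group, because it is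
    nilpotent and H has no nontrivial normal p'-subgroup.  So the image of P is
    normal in H, with a complement Q whose elements normalise all its subgroups,
    and coprime_power_action applies. *)
Lemma p'power_action_dichotomy (gT : finGroupType) (p : nat) (G P : {group gT}) :
    solvable G -> p'power_action G -> p.-Sylow(G) P ->
  p^'.-Hall(G) 'O_p^'(G) \/ (P <| G /\ abelian P).
Proof.
move=> solG actG sylP; set K := 'O_p^'(G).
have nsKG : K <| G := pcore_normal _ _; have nKG := normal_norm nsKG.
pose H := (G / K)%G; have sPG := pHall_sub sylP; have pP := pHall_pgroup sylP.
have solH : solvable H := quotient_sol _ solG.
have actH : p'power_action H := p'power_action_quotient nsKG actG.
have p'H1 : 'O_p^'(H) = 1 := trivg_pcore_quotient _ _.
have nilH' := p'power_action_der1_nil solH actH.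
have pH' : p.-group H^`(1).
  have O1 : 'O_p^'(H^`(1)) = 1.
    apply/trivgP; rewrite -p'H1 pcore_max ?pcore_pgroup //.
    by rewrite gFnormal_trans ?der_normal.
  by have := nilpotent_pcoreC p nilH'; rewrite O1 dprodg1 => <-; apply: pcore_pgroup.
have sylPK : p.-Sylow(H) (P / K)%G by rewrite quotient_pHall ?(subset_trans sPG).
have sH'P : H^`(1) \subset P / K.
  by rewrite (normal_sub_max_pgroup (Hall_max sylPK)) ?der_normal.
have nsPK : (P / K)%G <| H := sub_der1_normal sH'P (pHall_sub sylPK).
have [Q hallQ] := Hall_exists p^' solH.
have p'Q := pHall_pgroup hallQ.
have nSQ (S : {group coset_of K}) : S \subset (P / K)%G -> Q \subset 'N(S).
  move=> sSP; apply/subsetP=> y Qy; apply: (actH p 1%G (P / K)%G) => //.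
  - exact: normal1.
  - exact: sub1G.
  - by rewrite indexg1; apply: pHall_pgroup sylPK.
  - exact: subsetP (pHall_sub hallQ) y Qy.
  exact: mem_p_elt p'Q Qy.
have [cPQ | [abPK defPQ]] := coprime_power_action (pHall_pgroup sylPK) p'Q nSQ.
  left; have defH : (P / K) * Q = H.
    have : Q \in [complements to (P / K)%G in H] by rewrite (compl_pHall Q sylPK).
    by case/complP.
  have nsQH : Q <| H.
    rewrite /normal (pHall_sub hallQ) -{1}defH mul_subG ?normG //.
    by rewrite cents_norm // centsC.
  have Q1 : Q :=: 1 by apply/trivgP; rewrite -p'H1 pcore_max.
  rewrite /pHall pcore_sub pcore_pgroup pnatNK -card_quotient //.
  rewrite -[G / K]/(gval H) -defH Q1 mulg1.
  exact: pHall_pgroup sylPK.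
have tiPK : P :&: K = 1.
  by apply: coprime_TIg; apply: pnat_coprime pP (pcore_pgroup _ _).
have nKP := subset_trans sPG nKG.
right; split.
  have nilG' := p'power_action_der1_nil solG actG.
  have nsAG : 'O_p(G^`(1)) <| G by rewrite gFnormal_trans ?der_normal.
  have sAP : 'O_p(G^`(1)) \subset P.
    by rewrite (normal_sub_max_pgroup (Hall_max sylP)) ?pcore_pgroup.
  (* As P / K = [P / K, Q] lies in H', the order of P divides that of G'. *)
  suffices <- : 'O_p(G^`(1)) = P by [].
  apply/eqP; rewrite eqEcard sAP dvdn_leq ?cardG_gt0 //.
  rewrite (card_Hall (nilpotent_pcore_Hall p nilG')).
  rewrite -(part_pnat_id pP) partn_dvd ?cardG_gt0 //.
  have -> : #|P| = #|P / K| by rewrite card_quotient // -indexgI tiPK indexg1.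
  apply: dvdn_trans (_ : #|G^`(1) / K| %| _); last exact: dvdn_quotient.
  have -> : G^`(1) / K = H^`(1) := quotient_der 1 nKG.
  rewrite cardSg //= -{1}defPQ commgSS ?(pHall_sub sylPK) //.
  exact: pHall_sub hallQ.
apply/derG1P/trivgP; rewrite -tiPK subsetI der_sub /=.
exact: der1_min.
Qed.

(** * Sylow subgroups modulo p-cores in SST-groups *)

Section CoreIndex.

Variable gT : finGroupType.
Implicit Types A B C G H K P Q R X : {group gT}.

(** |P : O_p(G)| divides p for each Sylow p-subgroup P of G.  The condition
    holds trivially when p is not prime, as the p-part of |G| is then 1. *)
Definition core_index G : Prop := forall p : nat, #|G|`_p %| p * #|'O_p(G)|.

(** A cyclic r-group C is the direct product of [C, A] and C_C(A), and its
    subgroups form a chain. *)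
Lemma cyclic_coprime_cent (r : nat) C A :
    r.-group C -> cyclic C -> r^'.-group A -> A \subset 'N(C) ->
  A \subset 'C(C) \/ 'C_C(A) = 1.
Proof.
move=> rC cycC r'A nCA; have coCA : coprime #|C| #|A| := pnat_coprime rC r'A.
have tiC : 'C_[~: C, A](A) = 1 := coprime_abel_cent_TI nCA coCA (cyclic_abelian cycC).
have sRC : [~: C, A] \subset C by rewrite commg_subl.
have sCC : 'C_C(A) \subset C by apply: subsetIl.
have /= [i oi] := p_natP (pgroupS sRC rC); have /= [j oj] := p_natP (pgroupS sCC rC).
have [leij | ltji] := leqP i j.
  left; rewrite centsC; apply/commG1P/trivgP; rewrite -tiC subsetI subxx.
  have : [~: C, A] \subset 'C_C(A).
    by rewrite -(cardSg_cyclic cycC) //= oi oj dvdn_exp2l.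
  by rewrite subsetI => /andP[].
right; apply/trivgP; rewrite -tiC subsetI subsetIr andbT.
by rewrite -(cardSg_cyclic cycC) //= oi oj dvdn_exp2l // ltnW.
Qed.

Lemma p'elt_neq (p r : nat) (k : gT) :
  k != 1 -> r.-elt k -> p^'.-elt k -> r != p.
Proof.
move=> ntk rk p'k.
have [r_pr r_dv _] := p_elt_pdiv ntk rk.
by have := pnatP _ (order_gt0 k) p'k r r_pr r_dv.
Qed.

Lemma permutable_norm_cycle (p r : nat) G P k :
    primary_permutable G -> P \subset G -> p.-group P ->
    k \in 'O_p^'(G) -> r.-elt k ->
  P \subset 'N(<[k]>).
Proof.
move=> permG sPG pP Ok rk.
have [-> | ntk] := eqVneq k 1; first by rewrite cycle1 norms1.
have p'k : p^'.-elt k := mem_p_elt (pcore_pgroup _ _) Ok.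
have nrp : r != p := p'elt_neq ntk rk p'k.
have skG : <[k]> \subset G by rewrite cycle_subG (subsetP (pcore_sub _ _) k Ok).
have permkP : permutes <[k]>%G P by apply: permG rk pP.
have tiOP : 'O_p^'(G) :&: P = 1.
  by rewrite setIC coprime_TIg ?(pnat_coprime pP (pcore_pgroup _ _)).
have nOP : P \subset 'N('O_p^'(G)) := subset_trans sPG (gFnorm _ _).
apply: (permutes_norm_inter (permutes_sym permkP) nOP); first by rewrite cycle_subG.
by rewrite tiOP sub1G.
Qed.

Lemma commg_TI P k x :
    P \subset 'N(<[k]>) -> P :&: <[k]> = 1 -> x \in P ->
  forall i, i \in <[k]> -> x ^ i \in P -> x \in 'C[i].
Proof.
move=> nkP tiPk Px i ki Pxi; apply/cent1P/commgP.
rewrite -in_set1 -[[set 1]]/(1 : {set gT}) -tiPk inE commgEl groupM ?groupV //=.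
rewrite -commgEl commgEr groupM // memJ_norm ?groupV // (subsetP nkP) //.
Qed.

(** If K is a supplement of X as in the definition of SS-permutability, then
    K contains O = O_{p'}(G), and P0 = K :&: P is a Sylow subgroup of K.  For each
    k in O, X^k P0 is therefore a p-subgroup; it lies in a conjugate P^i, with i
    in <k>.  If P0 does not centralise k, then i = 1, since P0 centralises i, and
    hence X^k <= P, which means that X centralises k. *)
Lemma SS_p_nilpotent_supplement (p : nat) G P X :
    primary_permutable G -> p.-Sylow(G) P -> p^'.-Hall(G) 'O_p^'(G) ->
    X \subset P -> SS_permutable X G -> prime p ->
  exists P0 : {group gT}, [/\ P0 \subset P, X * P0 = P &
    forall (r : nat) k, k \in 'O_p^'(G) -> r.-elt k ->
      X \subset 'C[k] \/ P0 \subset 'C[k]].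
Proof.
move=> permG sylP hallO sXP [sXG [K [supK permK]]] p_pr.
have [sKG defG] := supK; have pP := pHall_pgroup sylP; have sPG := pHall_sub sylP.
have pK : p.-nat #|G : K| := pnat_dvd (supplement_index supK) (pgroupS sXP pP).
have sOK : 'O_p^'(G) \subset K.
  apply: (p'sub_index sKG (pcore_sub _ _) _ pK (pcore_pgroup _ _)).
  by apply/permutes_norm/(subset_trans sKG)/gFnorm.
have defP : X * (K :&: P) = P.
  by rewrite group_modl // defG; apply/setIidPr.
have sylP0 : p.-Sylow(K) (K :&: P).
  rewrite /pHall subsetIl (pgroupS (subsetIr K P) pP) /= indexgI.
  rewrite -indexMg.
  have -> : P * K = G.
    apply/eqP; rewrite eqEsubset mul_subG //= -{1}defG mulSg //.
  by case/and3P: sylP.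
exists (K :&: P)%G; split=> // [|r k Ok rk]; first exact: subsetIr.
have nkP := permutable_norm_cycle permG sPG pP Ok rk.
have p'k : p^'.-elt k := mem_p_elt (pcore_pgroup _ _) Ok.
have tiPk : P :&: <[k]> = 1 by rewrite coprime_TIg ?(pnat_coprime pP p'k).
have Kk : k \in K := subsetP sOK k Ok.
have sP0P : K :&: P \subset P by apply: subsetIr.
have permXk : permutes (X :^ k)%G (K :&: P)%G.
  have := permutesJ k (permK p ((K :&: P) :^ k^-1)%G p_pr _).
  by rewrite /permutes /= conjsgKV pHallJ ?groupV //; apply.
have [-> | ntk] := eqVneq k 1.
  by left; rewrite sub_cent1 group1.
have nrp := p'elt_neq ntk rk p'k.
have r'P0 : r^'.-group (K :&: P).
  by apply: pi_pgroup (pgroupS sP0P pP) _; rewrite !inE eq_sym.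
pose L := (P <*> <[k]>)%G; pose J := (X :^ k <*> (K :&: P))%G.
have defL : L :=: P * <[k]> by rewrite /L /= norm_joinEl.
have sPL : P \subset L := joing_subl _ _.
have Lk : k \in L by rewrite (subsetP (joing_subr _ _)) ?cycle_id.
have sLG : L \subset G by rewrite join_subG sPG cycle_subG (subsetP sKG).
have pJ : p.-group J.
  rewrite /J /= (comm_joingE permXk) pgroupM pgroupJ (pgroupS sXP pP).
  exact: pgroupS sP0P pP.
have sJL : J \subset L.
  rewrite join_subG (subset_trans sP0P sPL) andbT -(conjGid Lk) conjSg.
  exact: subset_trans sXP sPL.
have [y Ly sJP] := Sylow_subJ (pHall_subl sPL sLG sylP) sJL pJ.
move: Ly; rewrite defL => /mulsgP[x i Px ki defy].
have {sJP} sJP : J \subset P :^ i by rewrite (subset_trans sJP) // defy conjsgM conjGid.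
have [sXPi sP0Pi] : X :^ k \subset P :^ i /\ K :&: P \subset P :^ i.
  by split; apply: subset_trans sJP; [apply: joing_subl | apply: joing_subr].
have nkP0 := subset_trans sP0P nkP.
have [cP0k | C1] := cyclic_coprime_cent rk (cycle_cyclic k) r'P0 nkP0.
  by right; rewrite -cent_cycle.
have i1 : i = 1.
  apply/set1P; rewrite -[[set 1]]/(1 : {set gT}) -C1 inE ki /=.
  rewrite -groupV; apply/centP=> z P0z; apply: commute_sym.
  apply/cent1P; apply: (commg_TI nkP tiPk (subsetP sP0P z P0z)).
    by rewrite groupV.
  by rewrite -mem_conjg (subsetP sP0Pi).
left; apply/subsetP=> z Xz.
apply: (commg_TI nkP tiPk (subsetP sXP z Xz) (cycle_id k)).
by rewrite i1 conjsg1 in sXPi; rewrite (subsetP sXPi) // memJ_conjg.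
Qed.

(** The index |P : A| is that of a subgroup of <x> containing x ^+ p. *)
Lemma index_expg_dvd (p : nat) P A x :
    prime p -> p.-group P -> P \subset A * <[x]> -> A \subset P ->
    x \in P -> x ^+ p \in A ->
  #|P : A| %| p.
Proof.
move=> p_pr pP sPAx sAP Px Axp.
have defP : A * <[x]> = P.
  by apply/eqP; rewrite eqEsubset sPAx mul_subG ?cycle_subG.
rewrite -defP indexMg; have sxpA : <[x ^+ p]> \subset A by rewrite cycle_subG.
apply: dvdn_trans (indexgS _ sxpA) _.
have [-> | ntx] := eqVneq x 1; first by rewrite expg1n indexgg dvd1n.
have [_ p_dv _] := p_elt_pdiv ntx (mem_p_elt pP Px).
rewrite -divgS ?cycleX // -!orderE orderXdiv // divnA // mulKn //.
Qed.

Lemma expg_index_normal G A x : A <| G -> x \in G -> x ^+ #|G : A| \in A.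
Proof.
move=> nsAG Gx; have Nx := subsetP (normal_norm nsAG) x Gx.
apply: coset_idr; first exact: groupX.
rewrite morphX // -card_quotient ?normal_norm //.
by apply/eqP; rewrite -order_dvdn order_dvdG ?mem_quotient.
Qed.

(** Only the case where G is p-nilpotent requires work.  For k in O = O_{p'}(G) of
    prime power order not centralised by P, the subgroup C_P(k) has index p in P,
    and all these subgroups coincide, since P is not covered by two proper
    subgroups.  So C_P(O), which lies in O_p(G), has index 1 or p in P. *)
Lemma primary_SS_core_index G :
    solvable G ->
    (forall (p : nat) H, H \subset G -> p.-group H -> SS_permutable H G) ->
  core_index G.
Proof.
move=> solG ssG p; have [p_pr | npr] := boolP (prime p); last first.
  by rewrite p_part lognE (negPf npr).
have permG : primary_permutable G.
  apply: (@primary_embedded_permutable _ (@SS_permutable gT)) ssG.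
  by move=> r q H A Q rH _; apply: SS_permutes_Sylow.
have [P sylP] := Sylow_exists p G.
have pP := pHall_pgroup sylP; have sPG := pHall_sub sylP.
rewrite -(card_Hall sylP).
have actG := primary_permutable_p'power_action permG.
have [hallO | [nsPG _]] := p'power_action_dichotomy solG actG sylP; last first.
  by rewrite (normal_Hall_pcore sylP nsPG) dvdn_mull.
set O := 'O_p^'(G) in hallO.
(* The elements of prime power order in O; 1 is one of them, as pdiv 1 = 1. *)
pose primelt k := (k \in O) && (p_elt (pred1 (pdiv #[k])) k).
have supp X : X \subset P -> exists P0 : {group gT}, [/\ P0 \subset P, X * P0 = P &
    forall k, primelt k -> X \subset 'C[k] \/ P0 \subset 'C[k]].
  move=> sXP; have ssX := ssG p X (subset_trans sXP sPG) (pgroupS sXP pP).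
  have [P0 [sP0 defP cP0]] := SS_p_nilpotent_supplement permG sylP hallO sXP ssX p_pr.
  by exists P0; split=> // k /andP[Ok rk]; apply: cP0 rk.
have centO A : A \subset P -> (forall k, primelt k -> A \subset 'C[k]) -> A \subset 'C(O).
  move=> sAP cA; rewrite centsC; apply: sub_Sylow_group => q q_pr.
  have [Q sylQ] := Sylow_exists q O; exists Q => //; apply/subsetP=> k Qk.
  rewrite -sub_cent1; apply: cA; rewrite /primelt (subsetP (pHall_sub sylQ)) //=.
  have qk : q.-elt k := mem_p_elt (pHall_pgroup sylQ) Qk.
  have [-> | ntk] := eqVneq k 1; first exact: p_elt1.
  have [_ _ [m om]] := p_elt_pdiv ntk qk.
  by rewrite om pdiv_pfactor.
have nsCG : 'C_P(O) <| G.
  have [_ defG _ _] := sdprodP (sdprod_Hall_p'coreP hallO sylP).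
  have nOP : P \subset 'N(O) := subset_trans sPG (gFnorm _ _).
  rewrite /normal (subset_trans (subsetIl P _)) //= -{1}defG mul_subG //.
    by rewrite cents_norm // centsC subsetIr.
  by rewrite normsI ?normG ?norms_cent.
have sCO : 'C_P(O) \subset 'O_p(G).
  by rewrite pcore_max // (pgroupS (subsetIl P _)).
suffices dvP : #|P : 'C_P(O)| %| p.
  rewrite -(Lagrange (subsetIl P 'C(O))) mulnC dvdn_mul // cardSg //.
have maxC k : primelt k -> ~~ (P \subset 'C[k]) ->
  #|P : 'C_P[k]| = p /\ 'C_P[k] <| P.
  move=> pk ncPk.
  have genP (X : {group gT}) : X \subset P -> ~~ (X \subset 'C[k]) -> X * 'C_P[k] = P.
    move=> sXP ncXk; have [P0 [sP0P defP cP0]] := supp X sXP.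
    have [cXk | cP0k] := cP0 k pk; first by rewrite cXk in ncXk.
    apply/eqP; rewrite eqEsubset mul_subG ?subsetIl //= -{1}defP mulgS //.
    by rewrite subsetI sP0P.
  have [eqCP | [N maxN sCN]] := maximal_exists (subsetIl P 'C[k]).
    by case/negP: ncPk; rewrite -eqCP subsetIr.
  have ltNP := maxgroupp maxN; have sNP := proper_sub ltNP.
  have sNk : N \subset 'C[k].
    apply: contraLR ltNP => /(genP N sNP); rewrite mulGSid // => ->.
    by rewrite properxx.
  have eqN : N :=: 'C_P[k] by apply/eqP; rewrite eqEsubset sCN subsetI sNP sNk.
  rewrite -eqN; split; first exact: p_maximal_index pP maxN.
  exact: p_maximal_normal pP maxN.
have [/existsP[k /andP[pk ncPk]] | /existsPn cPall] :=
  boolP [exists k, primelt k && ~~ (P \subset 'C[k])]; last first.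
  have cPO : P \subset 'C(O).
    apply: centO => // k pk; have := cPall k; rewrite pk negbK; exact.
  by rewrite (setIidPl cPO) indexgg dvd1n.
have [iM nsMP] := maxC k pk ncPk; set M := 'C_P[k] in iM nsMP.
suffices sMC : M \subset 'C(O).
  by rewrite -iM indexgS // subsetI sMC subsetIl.
apply: centO => [|l pl]; first exact: subsetIl.
apply/idPn => ncMl.
have [iN nsNP] := maxC l pl (contra (subset_trans (subsetIl P _)) ncMl).
set N := 'C_P[l] in iN nsNP.
have oMN : #|N| = #|M|.
  apply/eqP; rewrite -(eqn_pmul2r (prime_gt0 p_pr)) -{1}iN -iM.
  by rewrite !Lagrange ?subsetIl.
have [a Ma nCa] := subsetPn ncMl.
have [b Nb nMb] : exists2 b, b \in N & b \notin M.
  apply/subsetPn; apply: contra ncMl => sNM.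
  have eqNM : N = M by apply/eqP; rewrite eqEcard sNM oMN leqnn.
  suffices: M \subset 'C[l] by [].
  by rewrite -eqNM subsetIr.
have [[Pa Ca] [Pb Cb]] := (setIP Ma, setIP Nb).
have nCb : b \notin 'C[k] by apply: contra nMb => Ckb; rewrite inE Pb.
(* x is outside M and N, so that <x> has a supplement inside
   M :&: N; moreover x ^+ p lies in M :&: N. *)
pose x := a * b; have Px : x \in P by apply: groupM.
have sxP : <[x]> \subset P by rewrite cycle_subG.
have nkx : ~~ (<[x]> \subset 'C[k]) by rewrite cycle_subG groupMl.
have nlx : ~~ (<[x]> \subset 'C[l]) by rewrite cycle_subG groupMr.
have [P0 [sP0P defP cP0]] := supp <[x]>%G sxP.
have cP0k : P0 \subset 'C[k] by case: (cP0 k pk) => // /idPn[].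
have cP0l : P0 \subset 'C[l] by case: (cP0 l pl) => // /idPn[].
pose A := (M :&: N)%G; have sAM : A \subset M := subsetIl _ _.
have sAP : A \subset P := subset_trans sAM (subsetIl _ _).
have dvA : #|P : A| %| p.
  apply: (index_expg_dvd p_pr pP _ sAP Px).
    rewrite -{1}[P : {set gT}]invGid -defP invMG mulSg //.
    by rewrite !subsetI sP0P cP0k cP0l.
  by rewrite inE -{1}iM -iN !expg_index_normal.
have sMA : M \subset A.
  rewrite -indexg_eq1 -dvdn1 -(@dvdn_pmul2l p) ?prime_gt0 // muln1.
  by rewrite -{1}iM Lagrange_index ?subsetIl.
by case/negP: ncMl; rewrite (subset_trans sMA) // (subset_trans (subsetIr M N)) ?subsetIr.
Qed.

(** Let sigma be the set of the primes p such that no Sylow p-subgroup of H lies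
    in O_p(G).  The required supplement of H is K = F Y, where F is the product
    of the p-cores O_p(G) for p in sigma and Y is a Hall sigma'-subgroup of G.  For
    p in sigma the Sylow p-subgroup of K is O_p(G); otherwise it is a Sylow
    p-subgroup of G, which contains a Sylow p-subgroup of H. *)
Lemma core_index_SS G H :
    solvable G -> primary_permutable G -> core_index G -> H \subset G ->
  SS_permutable H G.
Proof.
move=> solG permG idxG sHG; split=> //.
pose sigma : nat_pred :=
  [pred p | ~~ [exists S : {group gT}, p.-Sylow(H) S && (S \subset 'O_p(G))]].
pose F := 'O_sigma('F(G))%G.
have nsFG : F <| G by rewrite gFnormal_trans ?Fitting_normal.
have [Y hallY] := Hall_exists sigma^' solG.
have sigF : sigma.-group F := pcore_pgroup _ _.
have sig'Y := pHall_pgroup hallY.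
pose K := (F <*> Y)%G.
have sFG := normal_sub nsFG; have sYG := pHall_sub hallY.
have defK : K :=: F * Y by rewrite /K /= norm_joinEr // (subset_trans sYG) ?normal_norm.
have sKG : K \subset G by rewrite join_subG sFG.
have nsFK : F <| K := normalS (joing_subl F Y) sKG nsFG.
have hallF : sigma.-Hall(K) F by case: (coprime_mulpG_Hall (esym defK) sigF sig'Y).
have nilF : nilpotent F := nilpotentS (pcore_sub _ _) (Fitting_nil G).
have sylK (p : nat) (R : {group gT}) : p \in sigma -> p.-Sylow(K) R -> R :=: 'O_p(G).
  move=> sig_p sylR; have pR := pHall_pgroup sylR.
  have sOF : 'O_p(G) \subset F.
    rewrite pcore_max ?(pi_pgroup (pcore_pgroup p G)) //.
    rewrite (normalS _ (Fitting_sub G)) ?pcore_normal // Fitting_max ?pcore_normal //.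
    exact: pgroup_nil (pcore_pgroup p G).
  have sOK : 'O_p(G) \subset K := subset_trans sOF (joing_subl F Y).
  apply/eqP; rewrite eqEsubset andbC.
  rewrite (normal_sub_max_pgroup (Hall_max sylR)) ?pcore_pgroup //=; last first.
    exact: normalS sOK sKG (pcore_normal p G).
  have sRF : R \subset F.
    by rewrite (sub_normal_Hall hallF) ?(pHall_sub sylR) // (pi_pgroup pR).
  have sylRF : p.-Sylow(F) R := pHall_subl sRF (normal_sub nsFK) sylR.
  rewrite (nilpotent_Hall_pcore nilF sylRF) pcore_max ?pcore_pgroup //.
  by rewrite gFnormal_trans.
have sylK' (p : nat) (R : {group gT}) : p \notin sigma -> p.-Sylow(K) R -> p.-Sylow(G) R.
  move=> sig'p; apply: pHall_p'index => //.
  have : sigma^'^'.-nat #|G : Y| by case/and3P: hallY.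
  rewrite pnatNK => sigGY; apply: pi_p'nat (_ : p \in sigma^') => //.
  exact: pnat_dvd (indexgS _ (joing_subr F Y)) sigGY.
exists K; split; last first.
  move=> p R p_pr sylR; have [sig_p | sig'p] := boolP (p \in sigma).
    rewrite /permutes (sylK p R) //; apply: permutes_norm (_ : H \subset 'N('O_p(G)%G)).
    exact: subset_trans sHG (gFnorm _ _).
  have sylRG := sylK' p R sig'p sylR.
  have [S /andP[sylS sSO]] : exists S : {group gT}, p.-Sylow(H) S && (S \subset 'O_p(G)).
    by apply/existsP; rewrite inE negbK in sig'p.
  apply/permutes_sym/permutes_Sylow => q q_pr.
  have [eqqp | nqp] := eqVneq q p.
    exists S; rewrite ?eqqp // /permutes.
    have sSR : S \subset R := subset_trans sSO (pcore_sub_Hall sylRG).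
    by rewrite mulGSid // mulSGid.
  have [Q sylQ] := Sylow_exists q H; exists Q => //.
  apply: (permG p q) => //; first by rewrite eq_sym.
  - exact: pHall_sub sylRG.
  - exact: subset_trans (pHall_sub sylQ) sHG.
  - exact: pHall_pgroup sylRG.
  exact: pHall_pgroup sylQ.
split=> //; apply/eqP; rewrite eqEcard mul_subG //=.
(* For p in sigma, |G : K| has p-part at most p, and p divides |H : H :&: K|. *)
have dvKH : #|G : K| %| #|H : K|.
  apply/dvdn_partP=> // p; rewrite mem_primes => /and3P[p_pr _ p_dv].
  have sig_p : p \in sigma.
    have [// | sig'p] := boolP (p \in sigma); have [R sylR] := Sylow_exists p K.
    have := sylK' p R sig'p sylR; case/and3P=> _ _ p'GR.
    have : p^'.-nat #|G : K|.
      by apply: pnat_dvd p'GR; rewrite indexgS ?(pHall_sub sylR).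
    by rewrite p'natE // p_dv.
  have [R sylR] := Sylow_exists p K; have defR := sylK p R sig_p sylR.
  apply: (@dvdn_trans p).
    rewrite -(@dvdn_pmul2l #|R|) ?cardG_gt0 // {1}(card_Hall sylR).
    rewrite -partnM ?cardG_gt0 // Lagrange // defR mulnC; exact: idxG.
  apply/idPn=> p'HK.
  have [S sylS] := Sylow_exists p (H :&: K).
  have sSK : S \subset K := subset_trans (pHall_sub sylS) (subsetIr H K).
  have [R1 sylR1 sSR1] := Sylow_superset sSK (pHall_pgroup sylS).
  have := sig_p; rewrite inE => /existsPn/(_ S)/negP[]; apply/andP; split.
    apply: (pHall_p'index (subsetIl H K) _ sylS).
    by rewrite indexgI p'natE.
  by rewrite -(sylK p R1 sig_p sylR1).
rewrite -LagrangeMr -(Lagrange sKG) mulnC leq_mul2r dvdn_leq ?orbT //.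
Qed.

Lemma core_index_SST G :
  solvable G -> primary_permutable G -> core_index G -> SST_group G.
Proof.
move=> solG permG idxG H K sHK sKG _ _.
by apply: core_index_SS => //; apply: subset_trans sKG.
Qed.

End CoreIndex.

(** * Lifting from the quotient by N'' *)

Section Lifting.

Variable gT : finGroupType.
Implicit Types A B D G H K M N P R S T W X Y Z : {group gT}.

(** The derived subgroup of a nilpotent group consists of non-generators. *)
Lemma nilpotent_der1_supplement M D :
  nilpotent M -> D \subset M -> M \subset M^`(1) * D -> D :=: M.
Proof.
move=> nilM sDM sMD; apply/eqP/idPn => neDM.
have [eqDM | [H maxH sDH]] := maximal_exists sDM; first by rewrite eqDM eqxx in neDM.
have ltHM := maxgroupp maxH; have sHM := proper_sub ltHM.
have nsHM : H <| M.
  rewrite /normal sHM; have [_ maxH'] := maxgroupP maxH.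
  have [eqN | ltN] := eqVproper (subsetIl M 'N(H)).
    by rewrite -{1}eqN subsetIr.
  have := maxH' 'N_M(H)%G ltN; rewrite subsetI sHM normG => /(_ isT) defN.
  have eqMH : M :=: H by apply: nilpotent_sub_norm; rewrite ?defN.
  by rewrite eqMH properxx in ltHM.
have nHM := normal_norm nsHM.
have ntMH : M / H != 1.
  by rewrite -subG1 quotient_sub1 // proper_subn.
have := sol_der1_proper (quotient_sol H (nilpotent_sol nilM)) (subxx _) ntMH.
rewrite -quotient_der // => /proper_subn/negP[].
apply: subset_trans (quotientS H sMD) _.
rewrite quotientMl ?(subset_trans (der_sub 1 M)) //.
by rewrite (quotientS1 sDH) mulg1.
Qed.

(** Put Z = M', let T / Z be O_{p'}(G / Z), and let W be a Hall p'-subgroup of T.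
    Then T = Z W, and the Frattini argument gives G = Z N_G(W); as Z consists of
    non-generators of M, the subgroup W is normal in G. *)
Lemma p_nilpotent_der1_lift (p : nat) G M :
    solvable G -> M <| G -> nilpotent M ->
    p^'.-Hall(G / M^`(1)) 'O_p^'(G / M^`(1)) ->
  p^'.-Hall(G) 'O_p^'(G).
Proof.
move=> solG nsMG nilM hallO; set Z := M^`(1)%G.
have nsZG : Z <| G by rewrite gFnormal_trans.
have [T defT sZT nsTG] := inv_quotientN nsZG (pcore_normal p^' (G / Z)%G).
have sTG := normal_sub nsTG; have solT := solvableS sTG solG.
have nZT : T \subset 'N(Z) := subset_trans sTG (normal_norm nsZG).
have [W hallW] := Hall_exists p^' solT.
have defG : T * 'N_G(W) = G by apply: Hall_Frattini_arg hallW.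
have sWT := pHall_sub hallW.
have defT' : Z * W = T.
  rewrite -norm_joinEr ?(subset_trans sWT) //.
  apply/eqP; rewrite eqEsubset join_subG sZT sWT /= -indexg_eq1.
  apply/eqP/(@pnat_1 p).
    case/and3P: hallW => _ _; rewrite pnatNK => pTW; apply: pnat_dvd pTW.
    by rewrite indexgS ?joing_subr.
  have : p^'.-group (T / Z) by rewrite -defT pcore_pgroup.
  rewrite /pgroup card_quotient // => p'TZ; apply: pnat_dvd p'TZ.
  by rewrite indexgS ?joing_subl.
have sWG := subset_trans sWT sTG.
have defG' : Z * 'N_G(W) = G.
  rewrite -{2}defG -defT' -mulgA; congr (_ * _).
  by rewrite mulSGid // subsetI sWG normG.
have sZM : Z \subset M := der_sub 1 M.
have sMN : M \subset 'N_G(W).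
  have <- : M :&: 'N_G(W) = M; last exact: subsetIr.
  apply: (@nilpotent_der1_supplement M (M :&: 'N_G(W))%G) => //; first exact: subsetIl.
  by rewrite /= setIC group_modl // defG' subsetI (normal_sub nsMG) subxx.
have nsWG : W <| G.
  rewrite /normal sWG -{1}defG' mul_subG ?subsetIr //.
  by rewrite (subset_trans sZM) ?(subset_trans sMN) ?subsetIr.
have hallWG : p^'.-Hall(G) W.
  apply: pHall_p'index hallW => //.
  case/and3P: hallO => _ _; rewrite -[M^`(1)]/(gval Z) defT.
  by rewrite index_quotient_eq ?normal_norm // (subset_trans (subsetIr G Z)).
by rewrite (normal_Hall_pcore hallWG nsWG).
Qed.

(** If G / N'' is not p-nilpotent, its Sylow p-subgroups are abelian, so that
    S' <= N'' for S Sylow in N.  If N is p-nilpotent, then N / O_{p'}(N) is a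
    quotient of S, whose first two derived subgroups coincide, and so is abelian;
    if S is abelian, so is O_p(N').  In both cases p does not divide |N''|. *)
Lemma PST_der2_p_nilpotent (p : nat) G N :
    solvable G -> N <| G -> PST_group N -> primary_permutable (G / N^`(2))%G ->
    p \in \pi(N^`(2)) ->
  p^'.-Hall(G) 'O_p^'(G).
Proof.
move=> solG nsNG pstN permGZ pZ; have sNG := normal_sub nsNG.
have solN := solvableS sNG solG; have actN := PST_p'power_action pstN.
have nilM := p'power_action_der1_nil solN actN.
have nsMG : N^`(1) <| G by rewrite gFnormal_trans.
have nsZG : N^`(2) <| G by rewrite gFnormal_trans.
have notp' (B : {group gT}) : p^'.-group B -> ~~ (N^`(2) \subset B).
  move=> p'B; apply/negP=> sZB; have := pgroupS sZB p'B.
  by rewrite p'groupEpi pZ.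
apply: (p_nilpotent_der1_lift solG nsMG nilM).
have solGZ : solvable (G / N^`(2))%G := quotient_sol _ solG.
have [P sylP] := Sylow_exists p (G / N^`(2))%G.
have actGZ := primary_permutable_p'power_action permGZ.
have [// | [nsP abP]] := p'power_action_dichotomy solGZ actGZ sylP.
have [S sylS] := Sylow_exists p N; have pS := pHall_pgroup sylS.
have sSN := pHall_sub sylS.
have sSZ : S^`(1) \subset N^`(2).
  have nZS : S \subset 'N(N^`(2)) := subset_trans sSN (der_norm 2 N).
  apply: der1_min => //; apply: abelianS abP.
  by rewrite (sub_normal_Hall sylP) ?quotientS ?(subset_trans sSN) ?quotient_pgroup.
have [hallO | [nsSN abS]] := p'power_action_dichotomy solN actN sylS.
  set O := 'O_p^'(N) in hallO; have p'O : p^'.-group O := pcore_pgroup _ _.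
  have nsON : O <| N := pcore_normal _ _; have nON := normal_norm nsON.
  have [_ defN _ _] := sdprodP (sdprod_Hall_p'coreP hallO sylS).
  have [N1 | ntN1] := eqsVneq (N / O)^`(1) 1.
    case/negP: (notp' _ p'O); apply: subset_trans (der_subS 1 N) _.
    by rewrite -quotient_sub1 ?(subset_trans (der_sub 1 N)) // quotient_der // N1.
  have ltN2 : (N / O)^`(2) \proper (N / O)^`(1).
    exact: sol_der1_proper (quotient_sol O solN) (der_sub 1 _) ntN1.
  case/negP: (proper_subn ltN2); rewrite -(quotient_der 2) //.
  have <- : S / O = N / O by rewrite -defN quotientMidl.
  by rewrite -quotient_der ?(subset_trans sSN) // quotientS.
pose M := N^`(1)%G; case/negP: (notp' 'O_p^'(M)%G (pcore_pgroup _ _)).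
have [_ mulM _ _] := dprodP (nilpotent_pcoreC p (nilM : nilpotent M)).
suffices abM : abelian (M / 'O_p^'(M)) by apply: der1_min abM; apply: gFnorm.
have := quotientMidr 'O_p^'(M)%G 'O_p(M); rewrite /= mulM => ->.
rewrite quotient_abelian // (abelianS _ abS) //.
rewrite (sub_normal_Hall sylS) ?pcore_pgroup //.
exact: subset_trans (pcore_sub _ _) (der_sub 1 N).
Qed.

(** Lifting along a nilpotent normal subgroup Z such that G is p-nilpotent for
    each prime p dividing |Z|. *)
Section NormalLift.

Variables (G Z : {group gT}).
Hypotheses (nsZG : Z <| G) (nilZ : nilpotent Z).
Hypothesis p_nilG : forall p : nat, p \in \pi(Z) -> p^'.-Hall(G) 'O_p^'(G).

Let nZG := normal_norm nsZG.

Lemma p'cores_TI z :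
  z \in Z -> (forall r : nat, r \in \pi(Z) -> z \in 'O_r^'(G)) -> z = 1.
Proof.
move=> Zz Oz; apply/eqP/idPn => ntz.
have r_pr : prime (pdiv #[z]) by rewrite pdiv_prime // order_gt1.
have r_dv : pdiv #[z] %| #[z] := pdiv_dvd _.
have rZ : pdiv #[z] \in \pi(Z).
  by rewrite mem_primes r_pr cardG_gt0 (dvdn_trans r_dv) ?order_dvdG.
have := mem_p_elt (pcore_pgroup _ _) (Oz _ rZ).
by rewrite /p_elt p'natE // r_dv.
Qed.

Lemma pgroup_sub_p'core (p r : nat) X :
  X \subset G -> p.-group X -> r != p -> r \in \pi(Z) -> X \subset 'O_r^'(G).
Proof.
move=> sXG pX nrp rZ; rewrite (sub_Hall_pcore (p_nilG rZ)) //.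
by apply: pi_pgroup pX _; rewrite !inE eq_sym.
Qed.

Lemma coset_eq_mul x y :
  x \in G -> y \in G -> coset Z x = coset Z y -> exists2 z, z \in Z & x = y * z.
Proof.
move=> Gx Gy eqxy; have [Nx Ny] := (subsetP nZG x Gx, subsetP nZG y Gy).
exists (y^-1 * x); last by rewrite mulKVg.
apply: coset_idr; first by rewrite groupM ?groupV.
by rewrite morphM ?groupV //= morphV //= -eqxy mulVg.
Qed.

Lemma norm_lift (q : nat) X Y :
    X \subset G -> Y \subset G -> q.-group Y -> q \notin \pi(Z) ->
    X / Z \subset 'N(Y / Z) ->
  X \subset 'N(Y).
Proof.
move=> sXG sYG qY q'Z nYX; apply/subsetP=> x Xx; rewrite inE.
apply/subsetP=> _ /imsetP[y Yy ->].
have [Gx Gy] := (subsetP sXG x Xx, subsetP sYG y Yy).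
have Yxy : coset Z (y ^ x) \in Y / Z.
  rewrite morphJ ?(subsetP nZG) // memJ_norm ?mem_quotient //.
  by rewrite (subsetP nYX) ?mem_quotient.
case/morphimP: Yxy => y1 _ Yy1 eqy; have Gy1 := subsetP sYG y1 Yy1.
have [z Zz defyx] := coset_eq_mul (groupJ Gy Gx) Gy1 eqy.
suffices z1 : z = 1 by rewrite defyx z1 mulg1.
apply: p'cores_TI Zz _ => r rZ.
have sYO : Y \subset 'O_r^'(G).
  by apply: (pgroup_sub_p'core sYG qY _ rZ); apply: contraNneq q'Z => <-.
rewrite -(groupMl z (subsetP sYO y1 Yy1)) -defyx.
by rewrite memJ_norm ?(subsetP sYO) // (subsetP (gFnorm _ _)).
Qed.

(** If neither p nor q divides |Z|, then an equation y x = x1 y1 z with z in Z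
    forces z = 1.  If p divides |Z| but q does not, then X normalises Y modulo Z,
    hence normalises Y.  If both divide |Z|, then X and Y commute modulo Z, hence
    commute. *)
Lemma primary_permutable_lift :
  primary_permutable (G / Z)%G -> primary_permutable G.
Proof.
move=> permGZ p q X Y npq sXG sYG pX qY.
have permXY : permutes (X / Z)%G (Y / Z)%G.
  by apply: (permGZ p q); rewrite ?quotientS ?quotient_pgroup.
have normq (r s : nat) A B : r != s -> A \subset G -> B \subset G -> r.-group A -> s.-group B ->
    permutes (A / Z)%G (B / Z)%G -> r \in \pi(Z) -> A / Z \subset 'N(B / Z).
  move=> nrs sAG sBG rA sB permAB rZ.
  have sBO : B \subset 'O_r^'(G) := pgroup_sub_p'core sBG sB nrs rZ.
  apply: (@permutes_norm_inter _ (A / Z)%G (B / Z)%G ('O_r^'(G) / Z)%G permAB).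
  - by rewrite quotient_norms // (subset_trans sAG) ?gFnorm.
  - exact: quotientS.
  rewrite setIC coprime_TIg ?sub1G //; apply: (@pnat_coprime r).
    exact: quotient_pgroup.
  exact/quotient_pgroup/pcore_pgroup.
have nqp : q != p by rewrite eq_sym.
have [pZ | p'Z] := boolP (p \in \pi(Z)); have [qZ | q'Z] := boolP (q \in \pi(Z)).
- have cXY : X / Z \subset 'C(Y / Z).
    have nYX := normq p q X Y npq sXG sYG pX qY permXY pZ.
    have nXY := normq q p Y X nqp sYG sXG qY pX (permutes_sym permXY) qZ.
    apply/commG1P/trivgP.
    have <- : X / Z :&: Y / Z = 1.
      apply: coprime_TIg; apply: (@pnat_coprime p); first exact: quotient_pgroup.
      by apply: pi_pgroup (quotient_pgroup Z qY) _; rewrite !inE.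
    by rewrite subsetI commg_subl commg_subr nYX nXY.
  apply/permutes_norm/cents_norm/commG1P/trivgP; rewrite gen_subG.
  apply/subsetP=> _ /imset2P[x y Xx Yy ->]; apply/set1P.
  have [Gx Gy] := (subsetP sXG x Xx, subsetP sYG y Yy).
  apply: p'cores_TI => [|r rZ].
    have nZX := subset_trans sXG nZG; have nZY := subset_trans sYG nZG.
    have sRZ : [~: X, Y] \subset Z by rewrite -quotient_cents2.
    by rewrite (subsetP sRZ) ?mem_commg.
  have [Nx Ny] : x \in 'N('O_r^'(G)) /\ y \in 'N('O_r^'(G)).
    by rewrite !(subsetP (gFnorm _ _)).
  have [eqrp | nrp] := eqVneq r p.
    have Oy : y \in 'O_r^'(G).
      by rewrite (subsetP (pgroup_sub_p'core sYG qY _ rZ)) // eqrp.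
    by rewrite commgEr groupM // memJ_norm ?groupV.
  have Ox : x \in 'O_r^'(G) by rewrite (subsetP (pgroup_sub_p'core sXG pX nrp rZ)).
  by rewrite commgEl groupM ?groupV // memJ_norm.
- by apply/permutes_norm/(norm_lift sXG sYG qY q'Z)/(normq p q).
- apply/permutes_sym/permutes_norm/(norm_lift sYG sXG pX p'Z).
  by apply: (normq q p) => //; apply: permutes_sym.
have sYX : Y * X \subset X * Y.
  apply/subsetP=> _ /mulsgP[y x Yy Xx ->].
  have [Gx Gy] := (subsetP sXG x Xx, subsetP sYG y Yy).
  have : coset Z (y * x) \in (X / Z) * (Y / Z).
    rewrite permXY morphM ?(subsetP nZG) //.
    by rewrite mem_mulg // mem_quotient.
  case/mulsgP=> _ _ /morphimP[x1 Nx1 Xx1 ->] /morphimP[y1 Ny1 Yy1 ->].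
  rewrite -morphM // => eqyx.
  have [Gx1 Gy1] := (subsetP sXG x1 Xx1, subsetP sYG y1 Yy1).
  have [z Zz defyx] := coset_eq_mul (groupM Gy Gx) (groupM Gx1 Gy1) eqyx.
  rewrite defyx (p'cores_TI Zz) ?mulg1 ?mem_mulg // => r rZ.
  have sXO : X \subset 'O_r^'(G).
    by apply: (pgroup_sub_p'core sXG pX _ rZ); apply: contraNneq p'Z => <-.
  have sYO : Y \subset 'O_r^'(G).
    by apply: (pgroup_sub_p'core sYG qY _ rZ); apply: contraNneq q'Z => <-.
  have Oxy1 : x1 * y1 \in 'O_r^'(G) := groupM (subsetP sXO x1 Xx1) (subsetP sYO y1 Yy1).
  by rewrite -(groupMl z Oxy1) -defyx groupM ?(subsetP sXO x Xx) ?(subsetP sYO y Yy).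
apply/esym/eqP; rewrite eqEcard sYX /=.
by have := card_invg (X * Y); rewrite invMG => ->.
Qed.

(** If B / Z = O_p(G / Z), a Sylow p-subgroup A of B contains the Sylow p-subgroup
    of Z and centralises the others.  So A is normal in B = Z A, hence in G. *)
Lemma core_index_lift : core_index (G / Z)%G -> core_index G.
Proof.
move=> idxGZ p; have [B defB sZB nsBG] := inv_quotientN nsZG (pcore_normal p (G / Z)%G).
have sBG := normal_sub nsBG; have nZB := subset_trans sBG nZG.
have pBZ : p.-nat #|B : Z| by rewrite -card_quotient // -defB; apply: pcore_pgroup.
have [A sylA] := Sylow_exists p B; have pA := pHall_pgroup sylA.
have sAB := pHall_sub sylA; have sAG := subset_trans sAB sBG.
have nAZ : Z \subset 'N(A).
  apply: sub_Sylow_group => r r_pr; have [R sylR] := Sylow_exists r Z; exists R => //.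
  have defR := nilpotent_Hall_pcore nilZ sylR.
  have nsRG : R <| G by rewrite defR gFnormal_trans.
  have sRB : R \subset B := subset_trans (pHall_sub sylR) sZB.
  have [eqrp | nrp] := eqVneq r p.
    apply: subset_trans (normG A).
    rewrite (normal_sub_max_pgroup (Hall_max sylA)) ?(normalS sRB sBG) //.
    by rewrite -eqrp (pHall_pgroup sylR).
  have [-> | ntR] := eqsVneq R 1; first exact: sub1G.
  have rZ : r \in \pi(Z).
    have [_ r_dv _] := pgroup_pdiv (pHall_pgroup sylR) ntR.
    by rewrite mem_primes r_pr cardG_gt0 (dvdn_trans r_dv) ?cardSg ?(pHall_sub sylR).
  have sAO : A \subset 'O_r^'(G) := pgroup_sub_p'core sAG pA nrp rZ.
  apply/cents_norm/commG1P/trivgP.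
  have <- : R :&: 'O_r^'(G) = 1.
    apply: coprime_TIg; apply: pnat_coprime (pHall_pgroup sylR) (pcore_pgroup _ _).
  apply: commg_subI; rewrite subsetI ?subxx ?sAO /=.
    exact: subset_trans (normal_sub nsRG) (gFnorm _ _).
  exact: subset_trans sAG (normal_norm nsRG).
have defZA : Z <*> A = B.
  apply/eqP; rewrite eqEsubset join_subG sZB sAB /= -indexg_eq1.
  apply/eqP/(@pnat_1 p).
    by apply: pnat_dvd pBZ; rewrite indexgS ?joing_subl.
  by case/and3P: sylA => _ _ p'BA; apply: pnat_dvd p'BA; rewrite indexgS ?joing_subr.
have nsAB : A <| B by rewrite /normal sAB -{1}defZA join_subG nAZ normG.
have nsAG : A <| G by rewrite -(normal_Hall_pcore sylA nsAB) gFnormal_trans.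
have sAO : A \subset 'O_p(G) by rewrite pcore_max.
apply: dvdn_trans (_ : p * #|A| %| _); last by rewrite dvdn_mul // cardSg.
rewrite (card_Hall sylA) -(Lagrange sZB) -(Lagrange (normal_sub nsZG)).
rewrite !partnM ?cardG_gt0 // mulnCA dvdn_pmul2l ?part_gt0 //.
rewrite (part_pnat_id pBZ) -!card_quotient // -defB; exact: idxGZ.
Qed.

End NormalLift.

End Lifting.

(** * The characterisations and the theorem *)

Lemma primary_permutable_quotient (gT : finGroupType) (G Z : {group gT}) :
  Z <| G -> primary_permutable G -> primary_permutable (G / Z)%G.
Proof.
move=> nsZG permG p q X1 Y1 npq sX1 sY1 pX1 qY1.
have lift (r : nat) (X2 : {group coset_of Z}) : X2 \subset G / Z -> r.-group X2 ->
    exists X : {group gT}, [/\ X \subset G, r.-group X & X2 :=: X / Z].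
  move=> sX2 rX2; have [X defX sZX sXG] := inv_quotientS nsZG sX2.
  have [R sylR] := Sylow_exists r X; have nZX := subset_trans sXG (normal_norm nsZG).
  exists R; split; first exact: subset_trans (pHall_sub sylR) sXG.
    exact: pHall_pgroup sylR.
  have nZR := subset_trans (pHall_sub sylR) nZX.
  have := quotient_pHall nZR sylR; rewrite -defX => sylR2.
  exact/esym/(pHall_id sylR2).
have [X [sXG pX defX]] := lift p X1 sX1 pX1; have [Y [sYG qY defY]] := lift q Y1 sY1 qY1.
have nZ (A : {group gT}) : A \subset G -> A \subset 'N(Z).
  by move=> sAG; rewrite (subset_trans sAG) ?normal_norm.
rewrite /permutes defX defY -!quotientMl ?nZ //.
by rewrite (permG p q X Y).
Qed.

Lemma core_index_quotient1 (gT : finGroupType) (G Z : {group gT}) :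
  Z :=: 1 -> core_index G -> core_index (G / Z)%G.
Proof.
move=> Z1 idxG p.
have -> : 'O_p(G / Z) = 'O_p(G) / Z.
  by rewrite pquotient_pcore // Z1 ?normal1 ?pgroup1.
have oq (A : {group gT}) : #|A / Z| = #|A|.
  by rewrite card_quotient Z1 ?norms1 // indexg1.
by rewrite !oq.
Qed.

Lemma solvable_BTP (gT : finGroupType) (G : {group gT}) :
  solvable G -> (BT_group G <-> primary_permutable G).
Proof.
move=> solG; split; first exact: solvable_BT_primary_permutable.
exact: primary_permutable_BT.
Qed.

Lemma solvable_SSTP (gT : finGroupType) (G : {group gT}) :
  solvable G -> (SST_group G <-> primary_permutable G /\ core_index G).
Proof.
move=> solG; split=> [sstG | [permG idxG]]; last exact: core_index_SST.
have ssG := solvable_SST_primary_SS solG sstG.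
split; last exact: primary_SS_core_index.
apply: (@primary_embedded_permutable _ (@SS_permutable gT)) ssG.
by move=> r q H A Q rH _; apply: SS_permutes_Sylow.
Qed.

Theorem theorem1p17 (gT : finGroupType) (G : {group gT}) :
  (solvable G /\ SST_group G <->
   exists N : {group gT},
     [/\ N <| G,
         solvable N /\ PST_group N
       & solvable (G / N^`(2)) /\ SST_group (G / N^`(2))%G])
  /\
  (solvable G /\ BT_group G <->
   exists N : {group gT},
     [/\ N <| G,
         solvable N /\ PST_group N
       & solvable (G / N^`(2)) /\ BT_group (G / N^`(2))%G]).
Proof.
have PST1 : PST_group [1 gT].
  move=> H K sHK sK1 _ _; have sH1 := subset_trans sHK sK1.
  by split=> // p P _ _; apply/permutes1g/trivgP.
have d1 : [1 gT]^`(2) = 1 by apply/trivgP; apply: der_sub.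
have solG1 : solvable G -> solvable (G / [1 gT]^`(2)) by apply: quotient_sol.
have ns1 : [1 gT]^`(2) <| G by rewrite d1 normal1.
have solG (N : {group gT}) : N <| G -> solvable N -> solvable (G / N^`(2)) -> solvable G.
  move=> nsNG solN solGN; rewrite (series_sol (_ : N^`(2) <| G)) ?gFnormal_trans //.
  by rewrite solGN (solvableS (der_sub 2 N)).
have nilZ (N : {group gT}) : solvable N -> PST_group N -> nilpotent N^`(2).
  move=> solN pstN; apply: nilpotentS (der_subS 1 N) _.
  exact: p'power_action_der1_nil solN (PST_p'power_action pstN).
split; split.
- case=> sG /(solvable_SSTP sG)[permG idxG]; exists 1%G; split; first exact: normal1.
    by split=> //; apply: solvable1.
  split; first exact: solG1.
  apply/solvable_SSTP; first exact: solG1.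
  split; first exact: primary_permutable_quotient.
  exact: core_index_quotient1.
- case=> N [nsNG [solN pstN] [solGN sstGN]]; have sG := solG N nsNG solN solGN.
  split=> //; have [permGN idxGN] := (solvable_SSTP solGN).1 sstGN.
  have nsZG : N^`(2) <| G by rewrite gFnormal_trans.
  have pnil p pZ := PST_der2_p_nilpotent (p := p) sG nsNG pstN permGN pZ.
  apply/(solvable_SSTP sG); split.
    exact: primary_permutable_lift nsZG pnil permGN.
  exact: core_index_lift nsZG (nilZ N solN pstN) pnil idxGN.
- case=> sG /(solvable_BTP sG) permG; exists 1%G; split; first exact: normal1.
    by split=> //; apply: solvable1.
  split; first exact: solG1.
  apply/solvable_BTP; first exact: solG1.
  exact: primary_permutable_quotient.
case=> N [nsNG [solN pstN] [solGN btGN]]; have sG := solG N nsNG solN solGN.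
split=> //; have permGN := (solvable_BTP solGN).1 btGN.
have nsZG : N^`(2) <| G by rewrite gFnormal_trans.
have pnil p pZ := PST_der2_p_nilpotent (p := p) sG nsNG pstN permGN pZ.
apply/(solvable_BTP sG).
exact: primary_permutable_lift nsZG pnil permGN.
Qed.
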